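(* Suppose that Assumptions A, B, C and D of the context hold, and let $\{x^k\}$ be generated by the algorithm sMBA described in the context. Let $\Omega^*$ and $\psi^*$ be the solution set and the optimal value of problem (P), let $\mathrm{diam}(\Omega_0):=\sup_{x,y\in\Omega_0}\|x-y\|<\infty$, and let $$M_1:=M_L(\mu_0+M_\lambda)/2,\qquad M_2:=2\alpha_3/\check L,\qquad M_3:=2\max\{0,L_f-\check L\}/(\tau_1\check L),$$ with $M_L,M_\lambda$ the constants defined in the context. Then, for every $K\in\mathbb N_0$, $$\psi(x^{K+1})-\psi^*\le\frac{M_1}{\sum_{k=\lceil K/2\rceil}^K\mu_k}\left(M_2\sum_{k=\lceil K/2\rceil}^K\mu_k^2+M_3(\psi(x^0)-\psi^* )+\mathrm{diam}(\Omega_0)^2\right).$$ If, in addition, $\sum_{k=0}^\infty\mu_k^2<\infty$, then $\{x^k\}$ converges to some $x^*\in\Omega^*$.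
   Context: **Notation.** $\mathbb X,\mathbb Y$ are finite-dimensional real Hilbert spaces; $\mathbb N_0=\mathbb N\cup\{0\}$ with $\mathbb N=\{1,2,\dots\}$; $B(x,r)$ is the closed ball. For a cone $\mathcal K\subseteq\mathbb Y$, $\mathcal K^\circ=\{y:\langle y,w\rangle\le0\ \forall w\in\mathcal K\}$. A map is $L$-smooth if it is continuously differentiable with $L$-Lipschitz derivative; $DG(x)$ is the derivative of $G$, $DG(x)^*$ its adjoint, $\|DG(x)\|$ its operator norm. $\partial$ is the convex subdifferential. $\sigma_{\mathcal C}(y)=\sup_{u\in\mathcal C}\langle y,u\rangle$ is the support function. A base of a cone $\mathcal Q$ is a convex set $\mathcal D$ with $0\notin\mathrm{cl}(\mathcal D)$ and $\mathcal Q=\bigcup_{t\ge0}t\mathcal D$. **Problem (P).** Minimize $\psi(x):=f(x)+P_1(x)-P_2(x)$ over $x\in\mathbb X$ subject to $G(x)\in\mathcal K$. **Assumption A.** (i) $\mathcal K\subseteq\mathbb Y$ is a closed convex pointed cone with nonempty interior. (ii) $f:\mathbb X\to\mathbb R$ is $L_f$-smooth and $G:\mathbb X\to\mathbb Y$ is $L_G$-smooth, $L_f>0$, $L_G\ge0$. (iii) $P_1,P_2:\mathbb X\to\mathbb R$ are convex. (iv) There is $x^0\in\mathbb X$ with $G(x^0)\in\mathrm{int}(\mathcal K)$ such that $\Omega_0:=\{x:\psi(x)\le\psi(x^0),\ G(x)\in\mathcal K\}$ is bounded. (v) (Robinson's constraint qualification) $0\in\mathrm{int}(G(x)+DG(x)\mathbb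 X-\mathcal K)$ for all $x\in\Omega_0$. $\mathcal B$ is a fixed compact base of $\mathcal K^\circ$ (one exists), and $g_{\mathcal B}(x):=\sigma_{\mathcal B}(G(x))$. **Assumption B.** There are $\alpha_1\ge0$, $\alpha_2,\alpha_3,\alpha_4>0$ and a family $\{h_\mu\}_{\mu>0}$ of convex $C^1$ functions on $\mathbb Y$ such that for every $\mu>0$, $\nabla h_\mu$ is $(\alpha_1+\alpha_2/\mu)$-Lipschitz and $\sigma_{\mathcal B}(y)\le h_\mu(y)\le\sigma_{\mathcal B}(y)+\alpha_3\mu$ for all $y\in\mathbb Y$; and $h_{\mu_1}(y)\le h_{\mu_0}(y)-\alpha_4(\mu_0-\mu_1)$ for all $y\in\mathbb Y$ and $\mu_0>\mu_1>0$. Put $g_\mu(x):=h_\mu(G(x))$. **Assumption C.** The sequence $\{\mu_k\}_{k\in\mathbb N_0}$ used in the algorithm is positive, strictly decreasing, $\mu_k\to0$, and $\sum_{k=\lceil K/2\rceil}^K\mu_k\to\infty$ as $K\to\infty$. **Assumption D.** $P_2=0$, $f$ is convex, and $G$ is $(-\mathcal K)$-convex, i.e. $\lambda G(x)+(1-\lambda)G(z)\in G(\lambda x+(1-\lambda)z)-\mathcal K$ for all $x,z\in\mathbb X$, $\lambda\in[0,1]$. **Algorithm sMBA.** Input: $\tau_1,\tau_2>0$, $\hat L\ge\check L>0$, the point $x^0$ of Assumption A(iv), the family $\{h_\mu\}$. Step 1: find $\mu_0>0$ with $g_{\mu_0}(x^0)<0$; set $k=0$. Step 2: choose $\xi^k\in\partial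 P_2(x^k)$ and $L_f^{k,0},L_g^{k,0}\in[\check L,\hat L]$; set $i=j=0$. Step 3: set $L_f^{k,i}=2^iL_f^{k,0}$, $L_g^{k,j}=2^jL_g^{k,0}$; let $x^{k,i,j}$ be the unique solution, and $\lambda_{k,i,j}\ge0$ a Lagrange multiplier, of the problem of minimizing $\psi_{k,i}(x):=P_1(x)+\langle\nabla f(x^k)-\xi^k,x-x^k\rangle+\frac{L_f^{k,i}}2\|x-x^k\|^2$ subject to $g_{k,j}(x):=g_{\mu_k}(x^k)+\langle\nabla g_{\mu_k}(x^k),x-x^k\rangle+\frac{L_g^{k,j}}{2\mu_k}\|x-x^k\|^2\le0$. Step 4: if $g_{\mu_k}(x^{k,i,j})\le0$ and $\psi(x^{k,i,j})\le\psi(x^k)-\frac{\tau_1\mu_k+\tau_2\lambda_{k,i,j}}{2\mu_k}\|x^{k,i,j}-x^k\|^2$, set $i_k=i$, $j_k=j$ and go to Step 5; else if $g_{\mu_k}(x^{k,i,j})>0$, set $j\leftarrow j+1$ and go to Step 3; else set $i\leftarrow i+1$, $j\leftarrow j+1$ and go to Step 3. Step 5: set $x^{k+1}=x^{k,i_k,j_k}$, $\lambda_{k+1}=\lambda_{k,i_k,j_k}$, $L_f^k=L_f^{k,i_k}$, $L_g^k=L_g^{k,j_k}$; choose $\mu_{k+1}\in(0,\mu_k)$; $k\leftarrow k+1$; go to Step 2. **Constants.** $M_{\mathcal B}=\sup_{u\in\mathcal B}\|u\|$; $M_G=\sup_{x\in\Omega_0}\|DG(x)\|$; $g^*_{\mathcal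 B}=\inf_{x\in\Omega_0}g_{\mathcal B}(x)$; $M_R=\sqrt{\mu_0^2\check L^{-2}M_G^2M_{\mathcal B}^2-2\mu_0\check L^{-1}g^*_{\mathcal B}}+\mu_0\check L^{-1}M_GM_{\mathcal B}$; $\hat\Omega_0=\Omega_0+B(0,M_R)$; $\hat M_G=\sup\{\|DG(x)\|:x\in\mathrm{conv}(\hat\Omega_0)\}$; $L_\mu=M_{\mathcal B}L_G+\alpha_1\hat M_G^2+\alpha_2\hat M_G^2/\mu$; $M_L=\hat L\max\{2,2(L_f+\tau_1)/\check L\}\max\{2,2\tau_2/\check L,2\mu_0L_{\mu_0}/\check L\}$. $M_f=\sup_{x\in\Omega_0}\|\nabla f(x)\|$; $M_{P_1}=\sup_{x\in\hat\Omega_0}\{\|\zeta\|:\zeta\in\partial P_1(x)\}$; $M_{P_2}=\sup_{x\in\Omega_0}\{\|\xi\|:\xi\in\partial P_2(x)\}$. $\eta>0$ is a constant (one exists) such that for no $(x,u)\in\Omega_0\times\mathcal B$ do both $\|DG(x)^*u\|^2\le\eta$ and $-\langle u,G(x)\rangle\le\eta$ hold. $\bar t$ is the first positive integer with $\mu_{\bar t}<\eta/(2\alpha_3)$; $c_0=\min\{\mu_{t-1}/\mu_t-1:t=1,\dots,\bar t\}$; $\bar\eta=\sqrt{\min\{\eta,\,2\alpha_3\check L,\,-2\mu_0^{-1}\check Lg_{\mu_0}(x^0),\,2c_0\alpha_4\check L\}}$; $M_\lambda=\frac{M_f+M_{P_1}+M_{P_2}}{\bar\eta}+\frac{M_LM_G^2M_{\mathcal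 B}^2\mu_0}{2\check L\bar\eta^2}$. *)

(* Defs.v *)
From HB Require Import structures.
From mathcomp Require Import all_boot all_order all_algebra.
From mathcomp Require Import all_classical all_reals all_analysis.

Set Implicit Arguments.
Unset Strict Implicit.
Unset Printing Implicit Defensive.

Import Order.TTheory GRing.Theory Num.Theory.
Import numFieldNormedType.Exports.

Local Open Scope classical_set_scope.
Local Open Scope ring_scope.

(* Finite-dimensional real Hilbert spaces: completeness is automatic, and
   definiteness of the inner product follows from dotxx. *)
HB.mixin Record NormedModule_isEuclidean (R : realType) E
    of NormedModule R E & Vector R E := {
  dot : E -> E -> R ;
  dotC : forall x y, dot x y = dot y x ;
  dotDl : forall x y z, dot (x + y) z = dot x z + dot y z ;
  dotZl : forall (a : R) x y, dot (a *: x) y = a * dot x y ;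
  dotxx : forall x, dot x x = `|x| ^+ 2
}.

#[short(type="euclideanType")]
HB.structure Definition Euclidean (R : realType) :=
  {E of NormedModule R E & Vector R E & NormedModule_isEuclidean R E}.

Section Smooth.
Context {R : realType} {V W : normedModType R}.

Definition opnorm (A : V -> W) : R := sup [set `|A v| | v in [set v | `|v| <= 1]].

(* Continuity of the derivative is implied by the Lipschitz condition. *)
Definition smooth (L : R) (F : V -> W) :=
  (forall x, differentiable F x) /\
  (forall x y, opnorm (fun v => 'd F x v - 'd F y v) <= L * `|x - y|).

End Smooth.

Section Calculus.
Context {R : realType} {X Y : euclideanType R}.

(* The value is the adjoint when A is linear. *)
Definition adjoint (A : X -> Y) (u : Y) : X :=
  get [set w | forall v, dot v w = dot (A v) u].

(* The Riesz representative of the differential. *)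
Definition grad (f : X -> R) (x : X) : X :=
  get [set g | forall v, 'd f x v = dot g v].

Definition subdiff (P : X -> R) (x : X) : set X :=
  [set g | forall y, P x + dot g (y - x) <= P y].

Definition convex_hull (A : set X) : set X := smallest (@convex_set R X) A.

Definition is_cone (C : set X) := forall (t : R) w, 0 <= t -> C w -> C (t *: w).

Definition pointed_cone (C : set X) := forall w, C w -> C (- w) -> w = 0.

Definition polar (C : set X) : set X := [set y | forall w, C w -> dot y w <= 0].

Definition is_base (D Q : set X) :=
  [/\ convex_set D, ~ closure D 0 &
      Q = [set t *: d | t in [set t : R | 0 <= t] & d in D]].

Definition support_fun (C : set X) (y : X) : R := sup [set dot y u | u in C].

Definition is_minimizer (phi : X -> R) (A : set X) (x : X) :=
  A x /\ forall y, A y -> phi x <= phi y.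

(* lam is a Lagrange multiplier at x for minimizing phi subject to c <= 0,
   phi and c being convex. *)
Definition lagrange_multiplier (phi c : X -> R) (x : X) (lam : R) :=
  [/\ 0 <= lam, lam * c x = 0 &
      is_minimizer (fun y => phi y + lam * c y) setT x].

End Calculus.

(* The data of the problem, of the smoothing family and of the algorithm. *)
Record smba_data (R : realType) (X Y : euclideanType R) := SmbaData {
  obj_f : X -> R ;
  obj_P1 : X -> R ;
  obj_P2 : X -> R ;
  con_G : X -> Y ;
  con_K : set Y ;
  init_x : X ;
  L_f : R ;
  L_G : R ;
  base_B : set Y ;
  smooth_h : R -> Y -> R ;
  alpha1 : R ;
  alpha2 : R ;
  alpha3 : R ;
  alpha4 : R ;
  tau1 : R ;
  tau2 : R ;
  L_check : R ;
  L_hat : R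
}.

Section Problem.
Context {R : realType} {X Y : euclideanType R} (D : smba_data X Y).

Definition psi (x : X) : R := obj_f D x + obj_P1 D x - obj_P2 D x.

Definition feasible : set X := [set x | con_K D (con_G D x)].

Definition opt_value : R := inf [set psi x | x in feasible].

Definition solutions : set X := [set x | is_minimizer psi feasible x].

Definition Omega0 : set X := [set x | psi x <= psi (init_x D) /\ feasible x].

Definition robinson (x : X) :=
  [set con_G D x + 'd (con_G D) x v - w | v in setT & w in con_K D]° 0.

Record problem_assumption : Prop := {
  K_closed : closed (con_K D) ;
  K_convex : convex_set (con_K D) ;
  K_cone : is_cone (con_K D) ;
  K_pointed : pointed_cone (con_K D) ;
  K_solid : (con_K D)° !=set0 ;
  L_f_gt0 : 0 < L_f D ;
  L_G_ge0 : 0 <= L_G D ;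
  f_smooth : smooth (L_f D) (obj_f D : X -> R^o) ;
  G_smooth : smooth (L_G D) (con_G D) ;
  P1_convex : convex_function setT (obj_P1 D) ;
  P2_convex : convex_function setT (obj_P2 D) ;
  x0_slater : (con_K D)° (con_G D (init_x D)) ;
  Omega0_bounded : bounded_set Omega0 ;
  robinson_cq : forall x, Omega0 x -> robinson x
}.

Definition compact_base := compact (base_B D) /\ is_base (base_B D) (polar (con_K D)).

Definition g_B (x : X) : R := support_fun (base_B D) (con_G D x).

Definition g_ (mu : R) (x : X) : R := smooth_h D mu (con_G D x).

Record smoothing_assumption : Prop := {
  alpha1_ge0 : 0 <= alpha1 D ;
  alpha2_gt0 : 0 < alpha2 D ;
  alpha3_gt0 : 0 < alpha3 D ;
  alpha4_gt0 : 0 < alpha4 D ;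
  h_convex : forall mu, 0 < mu -> convex_function setT (smooth_h D mu) ;
  h_differentiable : forall mu y, 0 < mu -> differentiable (smooth_h D mu : Y -> R^o) y ;
  h_lipschitz : forall mu, 0 < mu ->
    (alpha1 D + alpha2 D / mu).-lipschitz (grad (smooth_h D mu)) ;
  h_approx : forall mu y, 0 < mu ->
    support_fun (base_B D) y <= smooth_h D mu y <= support_fun (base_B D) y + alpha3 D * mu ;
  h_decr : forall mu0 mu1 y, 0 < mu1 -> mu1 < mu0 ->
    smooth_h D mu1 y <= smooth_h D mu0 y - alpha4 D * (mu0 - mu1)
}.

Record convex_assumption : Prop := {
  P2_eq0 : forall x, obj_P2 D x = 0 ;
  f_convex : convex_function setT (obj_f D) ;
  G_convex : forall x z (t : R), 0 <= t <= 1 ->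
    exists2 w, con_K D w &
      t *: con_G D x + (1 - t) *: con_G D z = con_G D (t *: x + (1 - t) *: z) - w
}.

End Problem.

(* uphalf n is the upper integer part of n / 2. *)
Record stepsize_assumption (R : realType) (mu : nat -> R) : Prop := {
  mu_gt0 : forall k, 0 < mu k ;
  mu_decr : forall k, mu k.+1 < mu k ;
  mu_cvg0 : mu @ \oo --> (0 : R) ;
  mu_sum : (fun n => \sum_(uphalf n <= k < n.+1) mu k) @ \oo --> +oo
}.

(* Outer iterates x_ with their subgradients and initial constants; sub_x k i j
   and sub_lam k i j are the solution and the multiplier of the subproblem with
   indices k, i, j (meaningful only if the algorithm visits these indices), and
   i_ k, j_ k are the indices at which the inner loop stops. *)
Record smba_trace (R : realType) (X : euclideanType R) := SmbaTrace {
  x_ : nat -> X ;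
  xi_ : nat -> X ;
  mu_ : nat -> R ;
  L_f0_ : nat -> R ;
  L_g0_ : nat -> R ;
  sub_x : nat -> nat -> nat -> X ;
  sub_lam : nat -> nat -> nat -> R ;
  i_ : nat -> nat ;
  j_ : nat -> nat
}.

Section Algorithm.
Context {R : realType} {X Y : euclideanType R}.
Context (D : smba_data X Y) (T : smba_trace X).

Definition sub_obj (k i : nat) (x : X) : R :=
  obj_P1 D x + dot (grad (obj_f D) (x_ T k) - xi_ T k) (x - x_ T k)
  + (2 ^+ i * L_f0_ T k) / 2 * `|x - x_ T k| ^+ 2.

Definition sub_con (k j : nat) (x : X) : R :=
  g_ D (mu_ T k) (x_ T k)
  + dot (grad (g_ D (mu_ T k)) (x_ T k)) (x - x_ T k)
  + (2 ^+ j * L_g0_ T k) / (2 * mu_ T k) * `|x - x_ T k| ^+ 2.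

Definition subproblem_solved (k i j : nat) :=
  is_minimizer (sub_obj k i) [set x | sub_con k j x <= 0] (sub_x T k i j) /\
  lagrange_multiplier (sub_obj k i) (sub_con k j)
    (sub_x T k i j) (sub_lam T k i j).

Definition accepted (k i j : nat) :=
  g_ D (mu_ T k) (sub_x T k i j) <= 0 /\
  psi D (sub_x T k i j) <= psi D (x_ T k)
    - (tau1 D * mu_ T k + tau2 D * sub_lam T k i j) / (2 * mu_ T k)
      * `|sub_x T k i j - x_ T k| ^+ 2.

Inductive visited (k : nat) : nat -> nat -> Prop :=
| visited_init : visited k 0 0
| visited_infeasible i j :
    visited k i j -> ~ accepted k i j ->
    0 < g_ D (mu_ T k) (sub_x T k i j) -> visited k i j.+1
| visited_no_descent i j :
    visited k i j -> ~ accepted k i j ->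
    ~ 0 < g_ D (mu_ T k) (sub_x T k i j) -> visited k i.+1 j.+1.

Record smba_run : Prop := {
  tau1_gt0 : 0 < tau1 D ;
  tau2_gt0 : 0 < tau2 D ;
  L_check_gt0 : 0 < L_check D ;
  L_check_hat : L_check D <= L_hat D ;
  run_x0 : x_ T 0 = init_x D ;
  run_mu0_gt0 : 0 < mu_ T 0 ;
  run_mu0 : g_ D (mu_ T 0) (init_x D) < 0 ;
  run_mu : forall k, 0 < mu_ T k.+1 < mu_ T k ;
  run_xi : forall k, subdiff (obj_P2 D) (x_ T k) (xi_ T k) ;
  run_L_f0 : forall k, L_check D <= L_f0_ T k <= L_hat D ;
  run_L_g0 : forall k, L_check D <= L_g0_ T k <= L_hat D ;
  run_sub : forall k i j, visited k i j -> subproblem_solved k i j ;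
  run_visited : forall k, visited k (i_ T k) (j_ T k) ;
  run_accepted : forall k, accepted k (i_ T k) (j_ T k) ;
  run_next : forall k, x_ T k.+1 = sub_x T k (i_ T k) (j_ T k)
}.

End Algorithm.

Section Constants.
Context {R : realType} {X Y : euclideanType R}.
Context (D : smba_data X Y) (mu : nat -> R) (eta : R).

Definition M_B : R := sup [set `|u| | u in base_B D].

Definition M_G : R := sup [set opnorm ('d (con_G D) x) | x in Omega0 D].

Definition g_B_inf : R := inf [set g_B D x | x in Omega0 D].

Definition M_R : R :=
  Num.sqrt (mu 0%N ^+ 2 * L_check D ^- 2 * M_G ^+ 2 * M_B ^+ 2
            - 2 * mu 0%N * (L_check D)^-1 * g_B_inf)
  + mu 0%N * (L_check D)^-1 * M_G * M_B.

Definition Omega0_hat : set X :=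
  [set x + v | x in Omega0 D & v in [set v : X | `|v| <= M_R]].

Definition M_G_hat : R := sup [set opnorm ('d (con_G D) x) | x in convex_hull Omega0_hat].

Definition L_smooth (m : R) : R :=
  M_B * L_G D + alpha1 D * M_G_hat ^+ 2 + alpha2 D * M_G_hat ^+ 2 / m.

Definition M_L : R :=
  L_hat D
  * Num.max 2 (2 * (L_f D + tau1 D) / L_check D)
  * Num.max 2 (Num.max (2 * tau2 D / L_check D)
                       (2 * mu 0%N * L_smooth (mu 0%N) / L_check D)).

Definition M_f : R := sup [set `|grad (obj_f D) x| | x in Omega0 D].

Definition M_P1 : R :=
  sup [set `|z| | z in \bigcup_(x in Omega0_hat) subdiff (obj_P1 D) x].

Definition M_P2 : R :=
  sup [set `|z| | z in \bigcup_(x in Omega0 D) subdiff (obj_P2 D) x].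

Definition eta_valid :=
  0 < eta /\
  ~ exists x u, [/\ Omega0 D x, base_B D u,
      `|adjoint ('d (con_G D) x) u| ^+ 2 <= eta & - dot u (con_G D x) <= eta].

Definition t_bar : nat :=
  get [set t : nat | [/\ (0 < t)%N, mu t < eta / (2 * alpha3 D) &
    forall s, (0 < s < t)%N -> ~ mu s < eta / (2 * alpha3 D)]].

(* The minimum over 1 <= t <= t_bar, with the term t = 1 as default value. *)
Definition c_0 : R :=
  \big[Num.min/(mu 0%N / mu 1%N - 1)]_(1 <= t < t_bar.+1) (mu t.-1 / mu t - 1).

Definition eta_bar : R :=
  Num.sqrt (Num.min eta (Num.min (2 * alpha3 D * L_check D)
    (Num.min (- 2 * (mu 0%N)^-1 * L_check D * g_ D (mu 0%N) (init_x D))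
             (2 * c_0 * alpha4 D * L_check D)))).

Definition M_lambda : R :=
  (M_f + M_P1 + M_P2) / eta_bar
  + M_L * M_G ^+ 2 * M_B ^+ 2 * mu 0%N / (2 * L_check D * eta_bar ^+ 2).

Definition diam_Omega0 : R :=
  sup [set `|x - y| | x in Omega0 D & y in Omega0 D].

Definition M_1 : R := M_L * (mu 0%N + M_lambda) / 2.

Definition M_2 : R := 2 * alpha3 D / L_check D.

Definition M_3 : R := 2 * Num.max 0 (L_f D - L_check D) / (tau1 D * L_check D).

End Constants.

(* Main.v *)
(* The new iterate minimizes P_1 plus a quadratic, so minus the gradient of that
   quadratic is a subgradient of P_1 there, and the minimum grows quadratically.
   Since -K-convexity of G makes g_mu convex, comparison with a solution z gives
     psi(x^{k+1}) - psi^* <= lambda alpha_3 mu_k + (L_f - L_f^k)/2 |x^{k+1} - x^k|^2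
                             + w_k/2 (|z - x^k|^2 - |z - x^{k+1}|^2),
   where w_k = L_f^k + lambda L_g^k / mu_k. Dividing by w_k/2 <= M_1/mu_k and
   summing from K/2 to K yields the rate. For the convergence of the iterates,
   |z - x^k|^2 plus the remaining errors is nonincreasing for every solution z,
   and a cluster point of the iterates is a solution.

   The bound lambda <= M_lambda comes from v = grad g_mu(x^k) + (L_g/mu)(x^{k+1} - x^k):
   when the constraint is active, |v|^2 = |grad g_mu(x^k)|^2 - 2 (L_g/mu) g_mu(x^k),
   which is at least etabar^2, while stationarity expresses lambda v through
   bounded vectors. *)
Require Import Defs.
From HB Require Import structures.
From mathcomp Require Import all_boot all_order all_algebra.
From mathcomp Require Import all_classical all_reals all_analysis.
From mathcomp Require Import ring lra.

Import Order.TTheory GRing.Theory Num.Theory.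
Import numFieldNormedType.Exports.

Set Implicit Arguments.
Unset Strict Implicit.
Unset Printing Implicit Defensive.

Local Open Scope classical_set_scope.
Local Open Scope ring_scope.

(** * Euclidean spaces *)

(** The proof turns on two-sided control of the modulus [w_k], which may grow like [1 / mu_k]. From
    below, its term [lambda L_g / mu_k] with [L_g >= L_check] reduces the smoothing error
    [lambda alpha_3 mu_k], once divided by [w_k / 2], to at most [2 alpha_3 mu_k^2 / L_check],
    whatever [lambda] is: this is [M_2]. The displacement error is paid for by the descent required
    at acceptance, which gives [M_3]. From above, [mu_k w_k = mu_k L_f^k + lambda L_g^k] is at most
    [2 M_1] as soon as the backtracked constants and the multiplier are bounded uniformly in [k].
    The obstacle is that the curvature of [g_mu] is of order [1 / mu] and is controlled only near
    [Omega0]. The model constraint itself confines every trial point, rejected ones included, to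
    distance [M_R] of the iterate, so [L_smooth] applies to it. The link between smoothing and cone
    is that gradients of [h_mu] lie in the base [B]: polarity then makes [g_mu] convex, and [eta], a
    statement about elements of [B], applies to these gradients. *)

Section Dot.
Context {R : realType} {E : euclideanType R}.
Implicit Types x y z : E.

Lemma dotDr x y z : dot x (y + z) = dot x y + dot x z.
Proof. by rewrite dotC dotDl !(dotC x). Qed.

Lemma dotZr a x y : dot x (a *: y) = a * dot x y.
Proof. by rewrite dotC dotZl dotC. Qed.

Lemma dotNl x y : dot (- x) y = - dot x y.
Proof. by rewrite -scaleN1r dotZl mulN1r. Qed.

Lemma dotNr x y : dot x (- y) = - dot x y.
Proof. by rewrite dotC dotNl dotC. Qed.

Lemma dotBl x y z : dot (x - y) z = dot x z - dot y z.
Proof. by rewrite dotDl dotNl. Qed.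

Lemma dotBr x y z : dot x (y - z) = dot x y - dot x z.
Proof. by rewrite dotDr dotNr. Qed.

Lemma dot0l x : dot 0 x = 0.
Proof. by rewrite -(scale0r x) dotZl mul0r. Qed.

Lemma dot0r x : dot x 0 = 0.
Proof. by rewrite dotC dot0l. Qed.

Lemma normD_sqr x y : `|x + y| ^+ 2 = `|x| ^+ 2 + 2 * dot x y + `|y| ^+ 2.
Proof. by rewrite -!dotxx dotDl !dotDr (dotC y x); ring. Qed.

Lemma normB_sqr x y : `|x - y| ^+ 2 = `|x| ^+ 2 - 2 * dot x y + `|y| ^+ 2.
Proof. by rewrite normD_sqr dotNr normrN mulrN. Qed.

Lemma dot_le x y : dot x y <= `|x| * `|y|.
Proof.
have [->|y0] := eqVneq y 0; first by rewrite dot0r normr0 mulr0.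
have y_gt0 : 0 < `|y| by rewrite normr_gt0.
have [->|x0] := eqVneq x 0; first by rewrite dot0l normr0 mul0r.
have x_gt0 : 0 < `|x| by rewrite normr_gt0.
have := sqr_ge0 `|(`|y| *: x - `|x| *: y)|.
rewrite normB_sqr dotZl dotZr !normrZ !normr_id => h.
have xy : 0 < `|x| * `|y| by rewrite mulr_gt0.
rewrite -(ler_pM2l xy); nra.
Qed.

Lemma normr_dot_le x y : `|dot x y| <= `|x| * `|y|.
Proof. by rewrite ler_norml dot_le andbT lerNl -dotNl -normrN dot_le. Qed.

Lemma dot_inj x y : (forall v, dot v x = dot v y) -> x = y.
Proof.
move=> h; apply/eqP; rewrite -subr_eq0 -normr_eq0 -sqrf_eq0 -dotxx dotBr h.
by rewrite subrr.
Qed.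

End Dot.

Section Riesz.
Context {R : realType}.

(** The map sending [w] to [dot w] is linear and injective from [E] into its dual, which has the
    same dimension, so it is onto. *)
Lemma riesz (E : euclideanType R) (phi : {linear E -> R^o}) :
  exists w, forall v, phi v = dot w v.
Proof.
have lindot (w : E) : linear (dot w : E -> R^o).
  by move=> a x y; rewrite dotDr dotZr.
pose F (w : E) : {linear E -> R^o} :=
  HB.pack (dot w : E -> R^o) (GRing.isLinear.Build R E R^o _ (dot w) (lindot w)).
pose Phi (w : E) : 'Hom(E, R^o) := linfun (F w).
have linPhi : linear Phi.
  move=> a x y; apply/lfunP => v.
  by rewrite add_lfunE scale_lfunE !lfunE /= dotDl dotZl.
pose PhiL : {linear E -> 'Hom(E, R^o)} :=
  HB.pack Phi (GRing.isLinear.Build R E 'Hom(E, R^o) _ Phi linPhi).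
have ker0 : lker (linfun PhiL) == 0%VS.
  apply/lker0P => x y; rewrite !lfunE /= => /lfunP h; apply: dot_inj => v.
  by have := h v; rewrite !lfunE /= !(dotC v).
have : limg (linfun PhiL) = fullv.
  apply/eqP; rewrite eqEdim subvf limg_dim_eq; last first.
    by rewrite (eqP ker0) capv0.
  by rewrite !dimvf -[X in (_ <= X)%N]muln1 andTb; exact: leqnn.
move=> h; have : linfun phi \in limg (linfun PhiL) by rewrite h memvf.
case/memv_imgP => w _ /lfunP wE; exists w => v.
by have := wE v; rewrite !lfunE.
Qed.

(** [adjoint] is chosen by [get], so its defining property requires a witness, which Riesz
    representation provides. *)
Lemma adjointP (X Y : euclideanType R) (A : {linear X -> Y}) (u : Y) v :
  dot v (adjoint A u) = dot (A v) u.
Proof.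
have lin : linear (fun v => dot (A v) u : R^o).
  by move=> a x y; rewrite linearP dotDl dotZl.
pose phi : {linear X -> R^o} :=
  HB.pack (fun v => dot (A v) u : R^o) (GRing.isLinear.Build R X R^o _ _ lin).
have [w hw] := riesz phi.
suff /(_ v) : forall v, dot v (adjoint A u) = dot (A v) u by [].
by apply: (@getI _ [set w | forall v, dot v w = dot (A v) u] w) => z; rewrite dotC -hw.
Qed.

Lemma gradP (X : euclideanType R) (f : X -> R^o) x v : dot (grad f x) v = 'd f x v.
Proof.
have [w hw] := riesz ('d f x).
suff /(_ v) : forall v, 'd f x v = dot (grad f x) v by [].
by apply: (@getI _ [set g | forall v, 'd f x v = dot g v] w).
Qed.

End Riesz.

(** * Equivalence of norms and the Heine-Borel property *)

Section Compactness.
Import VectorInternalTheory.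
Context {R : realType}.

Lemma bounded_setP (V : normedModType R) (A : set V) :
  bounded_set A <-> exists M : R, forall x, A x -> `|x| <= M.
Proof.
split=> [[N [_ h]]|[M h]].
  by exists (N + 1) => x Ax; apply: h Ax; rewrite ltrDl.
exists M; split => [|N MN x Ax]; first exact: num_real.
exact/(le_trans (h _ Ax))/ltW.
Qed.

Context {E : euclideanType R}.

Lemma r2v_continuous : continuous (r2v : 'rV[R]_(dim E) -> E).
Proof.
have -> : (r2v : 'rV[R]_(dim E) -> E) =
    (fun u => \sum_j (u 0 j *: (r2v (delta_mx 0 j) : E))).
  apply/funext => u; rewrite {1}(row_sum_delta u) linear_sum.
  by apply: eq_bigr => j _; rewrite linearZ.
move=> u; apply: (@cvg_big E 'I_(dim E) +%R 0 xpredT _ _ (nbhs u)) => [|j _].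
  exact: add_continuous.
by apply: cvgZl; exact: coord_continuous.
Qed.

(** The continuous function [|r2v u|] attains its minimum on the compact unit sphere of row vectors,
    and injectivity of [r2v] makes this minimum positive. *)
Lemma norm_r2v_ge : exists2 m : R, 0 < m &
  forall u : 'rV[R]_(dim E), m * `|u| <= `|(r2v u : E)|.
Proof.
pose S := [set u : 'rV[R]_(dim E) | `|u| = 1].
have S1 u : u != 0 -> S (`|u|^-1 *: u).
  by move=> u0; rewrite /S /= normrZ normfV normr_id mulVf // normr_eq0.
(* In dimension 0 the sphere is empty and any positive constant will do. *)
have [S0|/set0P SN0] := eqVneq S set0.
  exists 1 => // u; have [->|/S1] := eqVneq u 0; last by rewrite S0.
  by rewrite normr0 mulr0.
have cS : compact S.
  apply: bounded_closed_compact.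
    by apply/bounded_setP; exists 1 => u /= ->.
  apply: (@preimage_closed _ _ (fun u : 'rV[R]_(dim E) => `|u|) [set 1]).
    by move=> u _; exact: norm_continuous.
  exact: closed_eq.
have cf : continuous (fun u : 'rV[R]_(dim E) => `|(r2v u : E)|).
  by move=> u; apply: (@cvg_norm _ _ _ (nbhs u)); exact: r2v_continuous.
have [c cS' hc] := compact_EVT_min SN0 cS (continuous_subspaceT cf).
have c0 : c != 0.
  apply/eqP => c0; move: cS'; rewrite inE /S /= c0 normr0 => /eqP.
  by rewrite eq_sym oner_eq0.
exists `|(r2v c : E)|.
  by rewrite normr_gt0; apply: contra_neq c0 => h; apply: r2v_inj; rewrite h linear0.
move=> u; have [->|u0] := eqVneq u 0; first by rewrite normr0 mulr0.
have /hc : (`|u|^-1 *: u) \in S by rewrite inE; exact: S1.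
by rewrite linearZ /= normrZ normfV normr_id ler_pdivlMl ?normr_gt0 // mulrC.
Qed.

(** Heine-Borel is transported from row vectors: by [norm_r2v_ge] the preimage of [A] under [r2v]
    stays bounded. *)
Lemma bounded_closed_compactE (A : set E) :
  bounded_set A -> closed A -> compact A.
Proof.
move=> /bounded_setP[M hM] cA; have [m m0 hm] := norm_r2v_ge.
have -> : A = r2v @` (r2v @^-1` A).
  apply/seteqP; split => [x Ax|_ [u Au <-] //].
  by exists (v2r x); rewrite /= ?v2rK.
apply: continuous_compact.
  exact/continuous_subspaceT/r2v_continuous.
apply: bounded_closed_compact.
  apply/bounded_setP; exists (M / m) => u Au.
  by rewrite ler_pdivlMr // mulrC (le_trans (hm u)) // hM.
by apply: preimage_closed => // u _; exact: r2v_continuous.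
Qed.

End Compactness.

Section Projection.
Context {R : realType} {E : euclideanType R}.

Lemma convex_setE (A : set E) x y (t : R) : convex_set A -> A x -> A y ->
  0 <= t <= 1 -> A (t *: x + (1 - t) *: y).
Proof.
move=> cA Ax Ay /andP[t0 t1].
have := cA x y (Itv01 t0 t1) (mem_set Ax) (mem_set Ay).
by rewrite inE.
Qed.

Lemma dist_continuous (y : E) : continuous (fun w : E => `|w - y|).
Proof.
by move=> u; apply: cvg_norm; apply: cvgB; [exact: cvg_id|exact: cvg_cst].
Qed.

Lemma convex_projection (A : set E) (y : E) :
  closed A -> convex_set A -> A !=set0 ->
  exists2 p, A p & forall w, A w -> dot (y - p) (w - p) <= 0.
Proof.
move=> clA cvA [a Aa].
pose S := A `&` [set w | `|w - y| <= `|a - y|].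
have cS : compact S.
  apply: bounded_closed_compactE.
    apply/bounded_setP; exists (`|a - y| + `|y|) => x [_ /= h].
    by rewrite -[x](subrK y) (le_trans (ler_normD _ _)) // lerD2r.
  apply: closedI => //.
  apply: (@preimage_closed _ _ (fun w : E => `|w - y|) [set t | t <= `|a - y|]).
    by move=> u _; exact: dist_continuous.
  exact: closed_le.
have SN0 : S !=set0 by exists a; split => /=.
have [p pS hp] := compact_EVT_min SN0 cS (continuous_subspaceT (@dist_continuous y)).
move: pS; rewrite inE => -[Ap pa].
have {}hp w : A w -> `|p - y| <= `|w - y|.
  move=> Aw; have [wa|wa] := leP `|w - y| `|a - y|; first by apply: hp; rewrite inE.
  exact: le_trans pa (ltW wa).
exists p => // w Aw; rewrite leNgt; apply/negP => d0.
set d := dot _ _ in d0; set n := `|w - p| ^+ 2.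
have n0 : 0 <= n by exact: sqr_ge0.
(* Moving from [p] towards [w] by [t] changes the squared distance to [y] by [t * (t * n - 2 * d)],
   which is negative for this [t]; [n + 1] keeps the denominator positive. *)
pose t := Num.min 1 (d / (n + 1)).
have t0 : 0 < t by rewrite lt_min ltr01 divr_gt0 // ltr_wpDl.
have t1 : t <= 1 by rewrite ge_min lexx.
have tn : t * (n + 1) <= d by rewrite -ler_pdivlMr ?ltr_wpDl // ge_min lexx orbT.
have At : A (t *: w + (1 - t) *: p).
  by apply: convex_setE => //; rewrite (ltW t0) t1.
have := hp _ At; rewrite -(@ler_pXn2r _ 2) ?nnegrE //.
have -> : t *: w + (1 - t) *: p - y = (p - y) + t *: (w - p).
  by rewrite scalerBl scale1r scalerBr addrCA addrAC.
rewrite [leRHS]normD_sqr normrZ exprMn real_normK ?num_real // dotZr.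
have -> : p - y = - (y - p) by rewrite opprB.
rewrite dotNl -/d -/n; nra.
Qed.

End Projection.

(** * Derivatives and convex functions *)

(* Linear identities between vectors are tested against an arbitrary vector. *)
Ltac vring := apply: dot_inj => ?; rewrite ?(dotDr, dotNr, dotZr, dot0r); ring.

Section OperatorNorm.
Context {R : realType} {V W : normedModType R}.

Section Bounded.
Context (A : V -> W) (C : R).
Hypothesis homA : forall a v, A (a *: v) = a *: A v.
Hypothesis boundA : forall v, `|A v| <= C * `|v|.

(** [opnorm] is a real [sup], informative only for a set bounded above; [boundA] secures this. *)
Let ubA : ubound [set `|A v| | v in [set v | `|v| <= 1]] `|C|.
Proof.
move=> _ [v /= v1 <-]; rewrite (le_trans (boundA v)) //.
by rewrite -[leRHS]mulr1 (le_trans (ler_wpM2r _ (ler_norm C))) // ler_wpM2l.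
Qed.

Lemma opnorm_ge0 : 0 <= opnorm A.
Proof.
apply: (ub_le_sup (ex_intro _ _ ubA)); exists 0; first by rewrite /= normr0.
by rewrite -(scale0r 0) homA scale0r normr0.
Qed.

Lemma opnorm_ler v : `|A v| <= opnorm A * `|v|.
Proof.
have [->|v0] := eqVneq v 0.
  by rewrite -(scale0r 0) homA !scale0r !normr0 mulr0.
rewrite -ler_pdivrMr ?normr_gt0 //; apply: (ub_le_sup (ex_intro _ _ ubA)).
exists (`|v|^-1 *: v); first by rewrite /= normrZ normfV normr_id mulVf ?normr_eq0.
by rewrite homA normrZ normfV normr_id mulrC.
Qed.

Lemma opnorm_le_bound : 0 <= C -> opnorm A <= C.
Proof.
move=> C0; rewrite -[leRHS]ger0_norm //; apply: (ge_sup _ ubA).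
by exists `|A 0|; exists 0 => //=; rewrite normr0.
Qed.

End Bounded.

Lemma diff_bounded (F : V -> W) x : differentiable F x ->
  exists C : R, forall v, `|'d F x v| <= C * `|v|.
Proof.
move=> dF; have /linear_bounded_continuous/linear_boundedP[C [_ hC]] :
  continuous ('d F x) by exact: diff_continuous.
by exists (C + 1) => v; apply: hC; rewrite ltrDl.
Qed.

Lemma diff_opnorm_ge0 (F : V -> W) x : differentiable F x ->
  0 <= opnorm ('d F x).
Proof.
move=> /diff_bounded[C hC]; apply: (opnorm_ge0 (C := C)) => // a v.
by rewrite linearZ.
Qed.

Lemma diff_opnorm_ler (F : V -> W) x v : differentiable F x ->
  `|'d F x v| <= opnorm ('d F x) * `|v|.
Proof.
move=> /diff_bounded[C hC]; apply: (opnorm_ler (C := C)) => // a u.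
by rewrite linearZ.
Qed.

Context (L : R) (F : V -> W).
Hypothesis smoothF : smooth L F.

Lemma smooth_diff_ler x y v :
  `|'d F x v - 'd F y v| <= L * `|x - y| * `|v|.
Proof.
have [dF lF] := smoothF.
have [C hC] := diff_bounded (dF x); have [C' hC'] := diff_bounded (dF y).
apply: le_trans (ler_wpM2r _ (lF x y)) => //.
apply: (@opnorm_ler (fun v => 'd F x v - 'd F y v) (C + C')).
  by move=> a u; rewrite scalerBr; congr (_ - _); exact: linearZ.
by move=> u; rewrite (le_trans (ler_normB _ _)) // mulrDl lerD.
Qed.

Lemma smooth_opnorm_bounded (A : set V) : 0 <= L -> bounded_set A ->
  exists M : R, forall x, A x -> opnorm ('d F x) <= M.
Proof.
have [dF lF] := smoothF.
move=> L0 /bounded_setP[M hM]; exists (opnorm ('d F 0) + L * M) => x Ax.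
have M0 : 0 <= M by rewrite (le_trans _ (hM x Ax)).
apply: opnorm_le_bound => [v|]; last by rewrite addr_ge0 ?mulr_ge0 ?diff_opnorm_ge0.
rewrite -['d F x v](subrK ('d F 0 v)) addrC mulrDl.
rewrite (le_trans (ler_normD _ _)) // lerD ?diff_opnorm_ler //.
rewrite (le_trans (smooth_diff_ler _ _ _)) // subr0 ler_wpM2r // ler_wpM2l //.
exact: hM.
Qed.

End OperatorNorm.

Section Lines.
Context {R : realType} {V : normedModType R}.

Lemma is_derive_line (f : V -> R^o) (x v : V) (t : R) :
  differentiable f (x + t *: v) ->
  is_derive t 1 (fun s : R => f (x + s *: v) : R^o) ('d f (x + t *: v) v).
Proof.
move=> df; have dv : derivable f (x + t *: v) v by exact: diff_derivable.
have E : (fun h : R => h^-1 *: (((fun s : R => f (x + s *: v) : R^o) \o shift t)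
      (h *: (1 : R)) - (f (x + t *: v) : R^o)))
    = (fun h : R => h^-1 *: ((f \o shift (x + t *: v)) (h *: v) - f (x + t *: v))).
  apply/funext => h /=; congr (_ *: (f _ - _)).
  by rewrite scalerDl [h *: 1]mulr1 addrCA.
apply: DeriveDef; first by rewrite /derivable E.
by rewrite -deriveE // /derive E.
Qed.

Lemma MVT01 (phi dphi : R -> R) :
  (forall t : R, is_derive t (1 : R) (phi : R -> R^o) (dphi t)) ->
  exists2 c, 0 <= c <= 1 & phi 1 - phi 0 = dphi c.
Proof.
move=> dphiP; have [|c c01 E] := @MVT_segment R phi dphi 0 1 ler01 (fun t _ => dphiP t).
  apply: continuous_subspaceT => t; apply/differentiable_continuous.
  by apply/derivable1_diffP; case: (dphiP t).
by exists c; [move: c01; rewrite in_itv | rewrite E subr0 mulr1].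
Qed.

(** The mean value theorem is applied to [phi] minus the quadratic with derivative [dphi 0 + C * t];
    this replaces integration of [dphi]. *)
Lemma quadratic_growth (phi dphi : R -> R) (C : R) :
  (forall t : R, is_derive t (1 : R) (phi : R -> R^o) (dphi t)) ->
  (forall t, 0 <= t <= 1 -> dphi t - dphi 0 <= C * t) ->
  phi 1 <= phi 0 + dphi 0 + C / 2.
Proof.
move=> dphiP h.
pose q (t : R) : R := phi t - (dphi 0 * t + C / 2 * t ^+ 2).
have dq (t : R) : is_derive t (1 : R) (q : R -> R^o) (dphi t - (dphi 0 + C * t)).
  have d1 : is_derive t (1 : R) ((fun s => dphi 0 * s + C / 2 * s ^+ 2) : R -> R^o)
      (dphi 0 + C * t).
    have -> : (fun s => dphi 0 * s + C / 2 * s ^+ 2) =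
        (dphi 0 \*: (@id R) + (C / 2) \*: ((@id R) ^+ 2)).
      by apply/funext => s; rewrite /GRing.add /= /GRing.scale /=.
    by apply: is_derive_eq; rewrite /GRing.scale /= expr1; field.
  exact: (is_deriveB (dphiP t) d1).
have [c c01] := MVT01 dq.
have := h c c01; rewrite /q; lra.
Qed.

Lemma derive_right_le (phi : R -> R) (d C : R) :
  is_derive (0 : R) (1 : R) (phi : R -> R^o) d ->
  (forall t, 0 < t <= 1 -> phi t - phi 0 <= t * C) -> d <= C.
Proof.
move=> [dphi <-] h; rewrite /derive.
have /cvg_dnbhs_at_right := dphi.
move=> /cvgr_to_le; apply.
near=> t; have t0 : 0 < t by near: t; exact: nbhs_right_gt.
have t1 : t <= 1 by near: t; exact: nbhs_right_le.
rewrite /= addr0 /GRing.scale /= mulr1 ler_pdivrMl //.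
by apply: h; rewrite t0.
Unshelve. all: by end_near. Qed.

End Lines.

(** * Local boundedness and continuity of convex functions, and proximal steps *)

Section ConvexFunctions.
Import VectorInternalTheory.
Context {R : realType} {E : euclideanType R} (f : E -> R).
Hypothesis cf : convex_function setT f.

Lemma convex_functionE x y (t : R) : 0 <= t <= 1 ->
  f (t *: x + (1 - t) *: y) <= t * f x + (1 - t) * f y.
Proof.
move=> /andP[t0 t1].
have := cf (Itv01 t0 t1) (mem_set (I : setT x)) (mem_set (I : setT y)).
by [].
Qed.

Lemma convex_gradient_le x y : differentiable (f : E -> R^o) x ->
  f x + 'd (f : E -> R^o) x (y - x) <= f y.
Proof.
move=> df; rewrite addrC -lerBrDr.
have dl : is_derive (0 : R) (1 : R) (fun s : R => f (x + s *: (y - x)) : R^o)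
    ('d (f : E -> R^o) x (y - x)).
  by have := @is_derive_line _ _ (f : E -> R^o) x (y - x) 0; rewrite scale0r addr0; apply.
apply: (derive_right_le dl) => t /andP[t0 t1]; rewrite scale0r addr0.
have -> : x + t *: (y - x) = t *: y + (1 - t) *: x by vring.
by have := @convex_functionE y x t; rewrite (ltW t0) t1 => /(_ isT); lra.
Qed.

(* The sum c_i e_i + S is the midpoint of 2 c_i e_i and 2 S, so the coefficient
   bound doubles at each step of the induction. *)
Lemma convex_bounded_above_sum (I : Type) (s : seq I) (e : I -> E) (C : R) :
  0 < C -> exists B : R, forall c : I -> R, (forall i, `|c i| <= C) ->
    f (\sum_(i <- s) c i *: e i) <= B.
Proof.
elim: s C => [|i s IHs] C C0; first by exists (f 0) => c _; rewrite big_nil.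
have [|B hB] := IHs (2 * C); first by rewrite mulr_gt0.
exists ((Num.max (f ((2 * C) *: e i)) (f ((- (2 * C)) *: e i)) + B) / 2) => c hc.
rewrite big_cons.
set S := \sum_(j <- s) _.
have S2 : f (2 *: S) <= B.
  rewrite scaler_sumr; under eq_bigr do rewrite scalerA.
  by apply: hB => j; rewrite normrM ger0_norm // ler_pM2l.
have -> : c i *: e i + S = (1 / 2) *: ((2 * c i) *: e i) + (1 - 1 / 2) *: (2 *: S).
  by apply: dot_inj => ?; rewrite !(dotDr, dotZr); field.
have half : 0 <= (1 / 2 : R) <= 1 by apply/andP; split; lra.
have := convex_functionE ((2 * c i) *: e i) (2 *: S) half.
pose t : R := (c i / C + 1) / 2.
have cC : -1 <= c i / C <= 1.
  by rewrite ler_pdivlMr // ler_pdivrMr // mulN1r mul1r -ler_norml.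
have t01 : 0 <= t <= 1 by move: cC => /andP[]; rewrite /t => ? ?; apply/andP; split; lra.
have -> : (2 * c i) *: e i = t *: ((2 * C) *: e i) + (1 - t) *: ((- (2 * C)) *: e i).
  by apply: dot_inj => ?; rewrite !(dotDr, dotZr) /t; field; exact: lt0r_neq0.
have := convex_functionE ((2 * C) *: e i) ((- (2 * C)) *: e i) t01.
set a := f ((2 * C) *: e i); set b := f ((- (2 * C)) *: e i).
set r := f (t *: _ + _) => hr.
have ma : a <= Num.max a b by rewrite le_max lexx.
have mb : b <= Num.max a b by rewrite le_max lexx orbT.
have rm : r <= Num.max a b by move: t01 => /andP[? ?]; nra.
set l := f (_ + _); lra.
Qed.

Lemma convex_bounded_above (M : R) :
  exists B : R, forall x, `|x| <= M -> f x <= B.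
Proof.
have [m m0 hm] := norm_r2v_ge (E := E).
(* Coordinates of a vector of norm at most [M] are at most [M / m]; the maximum with 1 ensures a
   positive bound. *)
have [|B hB] := @convex_bounded_above_sum 'I_(dim E) (index_enum _)
  (fun j => r2v (delta_mx 0 j)) (Num.max 1 (M / m)).
  by rewrite lt_max ltr01.
exists B => x xM.
have -> : x = \sum_j (v2r x 0 j *: (r2v (delta_mx 0 j) : E)).
  rewrite -[LHS]v2rK {1}(row_sum_delta (v2r x)) linear_sum.
  by apply: eq_bigr => j _; rewrite linearZ.
apply: hB => j; rewrite le_max; apply/orP; right.
rewrite ler_pdivlMr // mulrC.
have : `|v2r x 0 j| <= `|v2r x|.
  rewrite [leRHS]/Num.norm /= mx_normrE; apply/bigmax_geP; right => /=.
  by exists (ord0, j).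
have := hm (v2r x); rewrite v2rK => h1 h2.
by rewrite (le_trans _ (le_trans h1 xM)) // ler_pM2l.
Qed.

(** Convexity at 0, the midpoint of [x] and [- x], turns the upper bound at [- x] into a lower bound
    at [x]. *)
Lemma convex_bounded (M : R) :
  exists B : R, forall x, `|x| <= M -> `|f x| <= B.
Proof.
have [B hB] := convex_bounded_above M.
exists (`|B| + 2 * `|f 0|) => x xM.
have half : 0 <= (1 / 2 : R) <= 1 by apply/andP; split; lra.
have := convex_functionE x (- x) half.
rewrite (_ : (1 / 2) *: x + _ = 0); last first.
  by apply: dot_inj => ?; rewrite !(dotDr, dotZr, dotNr) dot0r; field.
have h1 := hB _ xM; have h2 : f (- x) <= B by apply: hB; rewrite normrN.
have hBn := ler_norm B; have f0 := ler_norm (f 0); have f0' := ler_norm (- f 0).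
rewrite normrN in f0'; have n0 := normr_ge0 (f 0).
have b0 := normr_ge0 B; rewrite ler_norml => h; apply/andP; split; lra.
Qed.

Lemma convex_lipschitz_ball (M : R) :
  exists2 C : R, 0 <= C &
    forall x y, `|x| <= M -> `|y| <= M -> f y - f x <= C * `|y - x|.
Proof.
have [B hB] := convex_bounded (M + 1).
have B0 (x : E) : `|x| <= M + 1 -> 0 <= B by move=> /hB; exact: le_trans.
exists (2 * `|B|) => [|x y xM yM]; first by rewrite mulr_ge0.
have [->|yx] := eqVneq y x; first by rewrite !subrr normr0 mulr0.
set d := `|y - x|; have d0 : 0 < d by rewrite normr_gt0 subr_eq0.
(* [z] lies one unit beyond [y] on the ray from [x], still in the larger ball. As [y] is a convex
   combination of [z] and [x] with weight [t <= d] on [z], the increment of [f] is at most [d] times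
   its oscillation there. *)
pose z := y + d^-1 *: (y - x).
have zM : `|z| <= M + 1.
  rewrite (le_trans (ler_normD _ _)) // lerD // normrZ normfV normr_id mulVf //.
  by rewrite lt0r_neq0.
have xM1 : `|x| <= M + 1 by rewrite (le_trans xM) // lerDl.
pose t := d / (1 + d).
have d1 : 0 < 1 + d by rewrite addr_gt0.
have t01 : 0 <= t <= 1.
  by rewrite /t divr_ge0 ?(ltW d0) ?(ltW d1) //= ler_pdivrMr // mul1r lerDr.
have td : t <= d by rewrite /t ler_pdivrMr // mulrDr mulr1 lerDl mulr_ge0 // ltW.
have := convex_functionE z x t01.
have -> : t *: z + (1 - t) *: x = y.
  apply: dot_inj => ?; rewrite /z /t !(dotDr, dotZr, dotNr); field.
  by rewrite !lt0r_neq0.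
have := hB _ zM; have := hB _ xM1; rewrite !ler_norml => /andP[? ?] /andP[? ?].
rewrite ger0_norm ?(B0 _ zM) // => h.
have B00 := B0 _ zM; move: t01 => /andP[? ?].
have : f y - f x <= t * (f z - f x) by lra.
have : t * (f z - f x) <= t * (2 * B) by rewrite ler_wpM2l //; lra.
have : t * (2 * B) <= d * (2 * B) by rewrite ler_wpM2r //; lra.
lra.
Qed.

Lemma convex_continuous : continuous (f : E -> R^o).
Proof.
move=> x; have [C C0 hC] := convex_lipschitz_ball (`|x| + 1).
apply/cvgrPdist_le => e e0.
near=> y.
have yx : `|x - y| <= Num.min 1 (e / (C + 1)).
  near: y; apply: cvgr_dist_le; first exact: cvg_id.
  by rewrite lt_min ltr01 divr_gt0 // ltr_wpDl.
have xM : `|x| <= `|x| + 1 by rewrite lerDl.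
have yM : `|y| <= `|x| + 1.
  rewrite -[y](subKr x) (le_trans (ler_normB _ _)) // lerD2l.
  by rewrite (le_trans yx) // ge_min lexx.
have : `|x - y| * (C + 1) <= e.
  by rewrite -ler_pdivlMr ?ltr_wpDl // (le_trans yx) // ge_min lexx orbT.
have := hC _ _ xM yM; have := hC _ _ yM xM; rewrite (distrC y).
have := normr_ge0 (x - y).
move=> ? ? ? ?; rewrite ler_norml; apply/andP; split; lra.
Unshelve. all: by end_near. Qed.

Lemma subdiff_bounded (A : set E) : bounded_set A ->
  exists C : R, forall x z, A x -> subdiff f x z -> `|z| <= C.
Proof.
move=> /bounded_setP[M hM]; have [B hB] := convex_bounded (M + 1).
exists (2 * B) => x z Ax dz.
have xM : `|x| <= M + 1 by rewrite (le_trans (hM _ Ax)) // lerDl.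
have B0 : 0 <= B by rewrite (le_trans _ (hB _ xM)).
have [->|z0] := eqVneq z 0; first by rewrite normr0 mulr_ge0.
have z_gt0 : 0 < `|z| by rewrite normr_gt0.
(* Tested one unit along its own direction, the subgradient [z] forces an increase of [f] by
   [|z|]. *)
have yM : `|x + `|z|^-1 *: z| <= M + 1.
  rewrite (le_trans (ler_normD _ _)) // lerD ?hM // normrZ normfV normr_id.
  by rewrite mulVf ?gt_eqF.
have := dz (x + `|z|^-1 *: z); rewrite addrAC subrr add0r dotZr dotxx.
rewrite expr2 mulrA mulVf ?gt_eqF // mul1r.
have := hB _ yM; have := hB _ xM; rewrite !ler_norml => /andP[? ?] /andP[? ?]; lra.
Qed.

Lemma ge0_of_small (a b : R) : (forall t, 0 < t <= 1 -> 0 <= a + t * b) -> 0 <= a.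
Proof.
move=> h; rewrite leNgt; apply/negP => a0.
have b1 : 0 < `|b| + 1 by rewrite ltr_wpDl.
pose t := Num.min 1 (- a / (2 * (`|b| + 1))).
have t0 : 0 < t by rewrite lt_min ltr01 divr_gt0 ?mulr_gt0 // oppr_gt0.
have t1 : t <= 1 by rewrite ge_min lexx.
have : t * (2 * (`|b| + 1)) <= - a.
  by rewrite -ler_pdivlMr ?mulr_gt0 // ge_min lexx orbT.
have := h t; rewrite t0 t1 => /(_ isT).
have := ler_norm b; nra.
Qed.

(** The Lagrangian of a subproblem has this form up to a constant, because the objective model and
    the constraint model are quadratics centred at the same point. *)
Definition prox_model (x g : E) (w : R) (y : E) : R :=
  f y + dot g (y - x) + w / 2 * `|y - x| ^+ 2.

(** Minimality is tested at [t *: y + (1 - t) *: xp]. After convexity of [f] and division by [t],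
    the quadratic term leaves a remainder of order [t], which vanishes as [t] tends to 0. *)
Lemma prox_subgradient (x xp g : E) (w : R) :
  (forall y, prox_model x g w xp <= prox_model x g w y) ->
  subdiff f xp (- (g + w *: (xp - x))).
Proof.
move=> h y; rewrite -subr_ge0.
apply: (@ge0_of_small _ (w / 2 * `|y - xp| ^+ 2)) => t /andP[t0 t1].
rewrite -(pmulr_rge0 _ t0).
have := convex_functionE y xp (t := t); rewrite (ltW t0) t1 => /(_ isT).
have := h (t *: y + (1 - t) *: xp); rewrite /prox_model.
have -> : t *: y + (1 - t) *: xp - x = (xp - x) + t *: (y - xp) by vring.
rewrite (normD_sqr (xp - x)) normrZ exprMn real_normK ?num_real // (dotDr _ (xp - x)) !dotZr.
rewrite dotNl (dotDl g) dotZl => *; nra.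
Qed.

Lemma prox_three_point (x xp g : E) (w : R) z :
  (forall y, prox_model x g w xp <= prox_model x g w y) ->
  prox_model x g w xp + w / 2 * `|z - xp| ^+ 2 <= prox_model x g w z.
Proof.
move=> /prox_subgradient /(_ z); rewrite /prox_model.
have -> : z - x = (xp - x) + (z - xp) by vring.
rewrite (normD_sqr (xp - x)) (dotDr _ (xp - x)) dotNl (dotDl g) dotZl; lra.
Qed.

End ConvexFunctions.

Section Gradients.
Context {R : realType}.

Lemma convex_functionI (E : euclideanType R) (f : E -> R) :
  (forall x y t, 0 <= t <= 1 -> f (t *: x + (1 - t) *: y) <= t * f x + (1 - t) * f y) ->
  convex_function setT f.
Proof. by move=> h t x y _ _; apply: h; rewrite ge0 le1. Qed.

Lemma norm_le_dot (E : euclideanType R) (w : E) (C : R) :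
  0 <= C -> (forall v, dot w v <= C * `|v|) -> `|w| <= C.
Proof.
move=> C0 h; have [->|w0] := eqVneq w 0; first by rewrite normr0.
by have := h w; rewrite dotxx expr2 ler_pM2r // normr_gt0.
Qed.

Context {X Y : euclideanType R}.

Lemma dot_diff (F : X -> Y) (u : Y) x : differentiable F x ->
  differentiable (fun z => dot (F z) u : R^o) x /\
  forall v, 'd (fun z => dot (F z) u : R^o) x v = dot ('d F x v) u.
Proof.
move=> dF.
have lin : linear (fun y : Y => dot y u : R^o).
  by move=> a y z; rewrite dotDl dotZl.
pose phi : {linear Y -> R^o} :=
  HB.pack (fun y : Y => dot y u : R^o) (GRing.isLinear.Build R Y R^o _ _ lin).
have cphi : continuous phi.
  apply/linear_bounded_continuous/linear_boundedP.
  exists `|u|; split => [|r ur y]; first exact: num_real.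
  by rewrite (le_trans (normr_dot_le _ _)) // mulrC ler_wpM2r // ltW.
have dphi : differentiable phi (F x) by exact: linear_differentiable.
split; first exact: (differentiable_comp dF dphi).
have E := diff_lin (F x) cphi; have E' := diff_comp dF dphi.
by move=> v; rewrite -[RHS]/(phi ('d F x v)) -[in RHS]E -[RHS]/(('d phi (F x) \o 'd F x) v) -E'.
Qed.

Lemma mean_value (F : X -> Y) (x v : X) (M : R) :
  (forall z, differentiable F z) ->
  (forall t, 0 <= t <= 1 -> `|'d F (x + t *: v) v| <= M) ->
  `|F (x + v) - F x| <= M.
Proof.
(* Pairing the increment with itself reduces the claim to the scalar mean value theorem and yields
   [|e|^2 <= M * |e|]. *)
move=> dF hM; set e := F (x + v) - F x.
have d t : is_derive t (1 : R) (fun s : R => dot (F (x + s *: v)) e : R^o)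
    (dot ('d F (x + t *: v) v) e).
  have [dd <-] := dot_diff e (dF (x + t *: v)).
  exact: is_derive_line dd.
have [c c01] := MVT01 d.
rewrite scale1r scale0r addr0 -dotBl -/e dotxx => E.
have [->|e0] := eqVneq e 0; first by rewrite normr0 (le_trans _ (hM c c01)).
have e_gt0 : 0 < `|e| by rewrite normr_gt0.
rewrite -(ler_pM2r e_gt0) -expr2 E (le_trans (dot_le _ _)) // ler_wpM2r //.
exact: hM.
Qed.

Lemma smooth_quadratic_bound (L : R) (f : X -> R^o) (x y : X) :
  smooth L f -> f y <= f x + dot (grad f x) (y - x) + L / 2 * `|y - x| ^+ 2.
Proof.
move=> sf; have [df _] := sf; have yE : y = x + (y - x) by rewrite addrC subrK.
rewrite {1}yE; set v := y - x.
have d t : is_derive t (1 : R) (fun s : R => f (x + s *: v) : R^o)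
  ('d f (x + t *: v) v) by exact: is_derive_line.
have := @quadratic_growth _ _ _ (L * `|v| ^+ 2) d.
rewrite scale1r !scale0r addr0 gradP => h.
rewrite mulrAC; apply: h => t /andP[t0 _].
rewrite (le_trans (ler_norm _)) // (le_trans (smooth_diff_ler sf _ _ _)) //.
by rewrite addrAC subrr add0r normrZ ger0_norm // expr2; lra.
Qed.

End Gradients.

(** * Support functions and cones *)

Section Support.
Context {R : realType} {Y : euclideanType R} (B : set Y).
Hypothesis cB : compact B.

Lemma support_ub y u : B u -> dot y u <= support_fun B y.
Proof.
move=> Bu; have /compact_bounded/bounded_setP[M hM] := cB.
apply: ub_le_sup; last by exists u.
exists (`|y| * M) => _ [w Bw <-].
by rewrite (le_trans (dot_le _ _)) // ler_wpM2l // hM.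
Qed.

Lemma norm_base_ler u : B u -> `|u| <= sup [set `|u| | u in B].
Proof.
move=> Bu; have /compact_bounded/bounded_setP[M hM] := cB.
by apply: ub_le_sup; [exists M => _ [w Bw <-]; exact: hM|exists u].
Qed.

Hypothesis B_neq0 : B !=set0.

Lemma support_le y c : (forall u, B u -> dot y u <= c) -> support_fun B y <= c.
Proof.
move=> h; apply: ge_sup => [|_ [u Bu <-]]; last exact: h.
by have [u Bu] := B_neq0; exists (dot y u), u.
Qed.

Hypothesis convB : convex_set B.

(** With [p] the projection of [u] onto [B], the support function at [u - p] is at most
    [dot p (u - p)]; the hypothesis in this direction gives [|u - p|^2 <= 0]. *)
Lemma mem_of_support u : (forall v, dot u v <= support_fun B v) -> B u.
Proof.
move=> h; have clB : closed B by apply: compact_closed => //; exact: norm_hausdorff.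
have [p Bp hp] := convex_projection u clB convB B_neq0.
have : support_fun B (u - p) <= dot p (u - p).
  apply: support_le => w /hp; rewrite dotBr => hw.
  by rewrite -subr_le0 (dotC p).
have := h (u - p); have := normr_ge0 (u - p).
have E : dot u (u - p) - dot p (u - p) = `|u - p| ^+ 2 by rewrite -dotBl dotxx.
move=> n0 h1 h2; have : `|u - p| ^+ 2 <= 0 by lra.
rewrite le_eqVlt ltNge sqr_ge0 orbF sqrf_eq0 normr_eq0 subr_eq0 => /eqP -> //.
Qed.

(* Along every ray the linear minorant of h grows at most like the support
   function of B, so the gradient cannot be separated from B. *)
Lemma grad_mem_base (h : Y -> R) (c : R) y : convex_function setT h ->
  differentiable (h : Y -> R^o) y ->
  (forall z, h z <= support_fun B z + c) -> B (grad h y).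
Proof.
move=> ch dh hle; apply: mem_of_support => v; rewrite leNgt; apply/negP => a0.
set a := dot (grad h y) v in a0; set s := support_fun B v in a0.
pose k := support_fun B y + c - h y.
have key t : 0 < t -> t * (a - s) <= k.
  move=> t0; have := convex_gradient_le ch (y + t *: v) dh.
  rewrite -gradP addrAC subrr add0r dotZr -/a.
  have := hle (y + t *: v).
  have : support_fun B (y + t *: v) <= support_fun B y + t * s.
    apply: support_le => w Bw; rewrite dotDl dotZl lerD ?support_ub //.
    by rewrite ler_pM2l // support_ub.
  rewrite /k; lra.
have as0 : 0 < a - s by rewrite subr_gt0.
have t0 : 0 < (`|k| + 1) / (a - s) by rewrite divr_gt0 // ltr_wpDl.
have := key _ t0; rewrite divfK ?gt_eqF //.
have := ler_norm k; lra.
Qed.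

End Support.

(** The residual [y - p] of the projection onto the cone is orthogonal to [p], as comparison with 0
    and with [2 *: p] shows. It therefore belongs to the polar cone, and the hypothesis applied to
    it gives [|y - p|^2 <= 0]. *)
Lemma bipolar (R : realType) (Y : euclideanType R) (K : set Y) y :
  closed K -> convex_set K -> is_cone K -> K !=set0 ->
  (forall u, polar K u -> dot u y <= 0) -> K y.
Proof.
move=> clK cvK coneK K0 h.
have [p Kp hp] := convex_projection y clK cvK K0.
have K00 : K 0 by rewrite -(scale0r p); exact: coneK.
have pp : dot (y - p) p = 0.
  have h0 := hp 0 K00; rewrite sub0r dotNr in h0.
  have h2 := hp (2 *: p) (coneK _ _ (ler0n _ 2) Kp).
  have E : 2 *: p - p = p by vring.
  by rewrite E in h2; apply/eqP; rewrite eq_le; apply/andP; split; lra.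
have /h : polar K (y - p).
  by move=> w Kw; have := hp w Kw; rewrite dotBr pp subr0.
have E : dot (y - p) y = `|y - p| ^+ 2.
  by rewrite -dotxx [in RHS]dotBr pp subr0.
rewrite E le_eqVlt ltNge sqr_ge0 orbF sqrf_eq0 normr_eq0 subr_eq0 => /eqP -> //.
Qed.

(** * The smoothed constraint *)

Section Constraint.
Context {R : realType} {X Y : euclideanType R} (D : smba_data X Y).
Hypothesis hA : problem_assumption D.
Hypothesis hbase : compact_base D.
Hypothesis hB : smoothing_assumption D.

Local Notation G := (con_G D).
Local Notation dual mu x := (grad (smooth_h D mu) (G x)).

Lemma base_compact : compact (base_B D). Proof. by case: hbase. Qed.

Lemma base_convex : convex_set (base_B D). Proof. by case: hbase => _ []. Qed.

Lemma base_nonempty : base_B D !=set0.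
Proof.
have [_ [_ _ E]] := hbase.
have : polar (con_K D) 0 by move=> w _; rewrite dot0l.
by rewrite E => -[t _ [d Bd _]]; exists d.
Qed.

Lemma base_sub_polar u : base_B D u -> polar (con_K D) u.
Proof.
by move=> Bu; have [_ [_ _ ->]] := hbase; exists 1 => //=; exists u => //; rewrite scale1r.
Qed.

Lemma K_nonempty : con_K D !=set0.
Proof.
by exists (con_G D (init_x D)); apply: interior_subset; exact: x0_slater hA.
Qed.

Lemma g_approx mu x : 0 < mu -> g_B D x <= g_ D mu x <= g_B D x + alpha3 D * mu.
Proof. by move=> mu0; exact: (h_approx hB). Qed.

Lemma g_B_le0 x : feasible D x -> g_B D x <= 0.
Proof.
move=> Kx; apply: (support_le base_nonempty) => u /base_sub_polar pu.
by rewrite dotC pu.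
Qed.

(** The base generates the polar cone and [g_B <= g_mu], so every polar vector pairs nonpositively
    with [G x]; the bipolar property concludes. *)
Lemma feasible_g mu x : 0 < mu -> g_ D mu x <= 0 -> feasible D x.
Proof.
move=> mu0 gx; have /andP[gB _] := g_approx x mu0.
apply: (@bipolar _ _ (con_K D) (G x));
  [exact: K_closed hA|exact: K_convex hA|exact: K_cone hA|exact: K_nonempty|].
have [_ [_ _ ->]] := hbase => _ [t /= t0 [d Bd <-]].
rewrite dotZl mulr_ge0_le0 // dotC (le_trans (support_ub base_compact _ Bd)) //.
exact: le_trans gB gx.
Qed.

(** This membership bounds the dual vectors by [M_B], gives them the sign of polar vectors, and
    makes [eta_valid] applicable to them. *)
Lemma dual_mem mu x : 0 < mu -> base_B D (dual mu x).
Proof.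
move=> mu0; apply: (@grad_mem_base _ _ _ _ _ _ _ (alpha3 D * mu)).
- exact: base_compact.
- exact: base_nonempty.
- exact: base_convex.
- exact: (h_convex hB).
- exact: (h_differentiable hB).
by move=> z; have /andP[] := h_approx hB z mu0.
Qed.

Lemma M_B_ge0 : 0 <= M_B D.
Proof.
by have [u Bu] := base_nonempty; rewrite (le_trans _ (norm_base_ler base_compact Bu)).
Qed.

Lemma norm_dual mu x : 0 < mu -> `|dual mu x| <= M_B D.
Proof. by move=> mu0; apply: (norm_base_ler base_compact); exact: dual_mem. Qed.

Lemma h_gradient_le mu x y : 0 < mu ->
  smooth_h D mu (G x) + dot (dual mu x) (y - G x) <= smooth_h D mu y.
Proof.
move=> mu0; rewrite gradP; apply: (convex_gradient_le (h_convex hB mu0)).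
exact: (h_differentiable hB).
Qed.

(** This is the gradient inequality of [h_mu] at the origin, where the support function is at most
    0. It converts a lower bound on [- dot u (G x)] into one on [- g_mu]. *)
Lemma g_le_dual mu x : 0 < mu -> g_ D mu x - alpha3 D * mu <= dot (dual mu x) (G x).
Proof.
move=> mu0; have := h_gradient_le x 0 mu0; rewrite sub0r dotNr.
have /andP[_] := h_approx hB 0 mu0.
have : support_fun (base_B D) 0 <= 0.
  by apply: (support_le base_nonempty) => u _; rewrite dot0l.
rewrite /g_; lra.
Qed.

Lemma G_differentiable x : differentiable G x.
Proof. by have [] := G_smooth hA. Qed.

Lemma g_diff mu x : 0 < mu ->
  differentiable (g_ D mu : X -> R^o) x /\
  forall v, 'd (g_ D mu : X -> R^o) x v = dot ('d G x v) (dual mu x).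
Proof.
move=> mu0; have dh := h_differentiable hB (G x) mu0.
have dG := G_differentiable x.
split; first exact: (differentiable_comp dG dh).
move=> v; rewrite (dotC ('d G x v)) gradP.
have E := diff_comp dG dh.
by rewrite -[RHS]/(('d (smooth_h D mu : Y -> R^o) (G x) \o 'd G x) v) -E.
Qed.

Lemma dot_grad_g mu x v : 0 < mu ->
  dot (grad (g_ D mu) x) v = dot ('d G x v) (dual mu x).
Proof. by move=> mu0; rewrite gradP; have [_ ->] := g_diff x mu0. Qed.

Lemma grad_g_adjoint mu x : 0 < mu ->
  grad (g_ D mu) x = adjoint ('d G x) (dual mu x).
Proof.
by move=> mu0; apply: dot_inj => v; rewrite adjointP dotC dot_grad_g.
Qed.

Lemma norm_grad_g mu x : 0 < mu ->
  `|grad (g_ D mu) x| <= opnorm ('d G x) * M_B D.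
Proof.
move=> mu0; have o0 := diff_opnorm_ge0 (G_differentiable x).
apply: norm_le_dot => [|v]; first by rewrite mulr_ge0 ?M_B_ge0.
rewrite dot_grad_g // (le_trans (dot_le _ _)) // mulrAC.
by rewrite ler_pM ?norm_dual ?diff_opnorm_ler //; exact: G_differentiable.
Qed.

(** The derivative of [g_mu] along the segment pairs ['d G] with the dual vector. The variation of
    the first factor costs [M_B * L_G], that of the second [(alpha1 + alpha2 / mu) * M ^+ 2]; their
    sum is the origin of [L_smooth]. *)
Lemma g_quadratic_bound mu x v (M : R) : 0 < mu ->
  (forall t, 0 <= t <= 1 -> opnorm ('d G (x + t *: v)) <= M) ->
  g_ D mu (x + v) <= g_ D mu x + dot (grad (g_ D mu) x) v
   + (M_B D * L_G D + alpha1 D * M ^+ 2 + alpha2 D * M ^+ 2 / mu) / 2 * `|v| ^+ 2.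
Proof.
move=> mu0 hM.
have M0 : 0 <= M.
  have := hM 0; rewrite lexx ler01 => /(_ isT); apply: le_trans.
  exact/diff_opnorm_ge0/G_differentiable.
pose dphi t := dot ('d G (x + t *: v) v) (dual mu (x + t *: v)).
have d t : is_derive t (1 : R) (fun s : R => g_ D mu (x + s *: v) : R^o) (dphi t).
  by have [dg E] := g_diff (x + t *: v) mu0; rewrite /dphi -E; exact: is_derive_line.
set C := _ + _ + _ / mu.
have := @quadratic_growth _ _ _ (C * `|v| ^+ 2) d.
rewrite scale1r !scale0r addr0 /dphi scale0r addr0 -(dot_grad_g _ _ mu0) => h.
rewrite mulrAC; apply: h => t /[dup] t01 /andP[t0 t1].
set xt := x + t *: v.
have nGt : `|G xt - G x| <= M * (t * `|v|).
  apply: mean_value => [z|s /andP[s0 s1]]; first exact: G_differentiable.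
  rewrite (le_trans (diff_opnorm_ler _ (G_differentiable _))) // normrZ ger0_norm //.
  by rewrite ler_wpM2r ?mulr_ge0 // scalerA hM // mulr_ge0 //= mulr_ile1.
have n1 : `|'d G xt v - 'd G x v| <= L_G D * (t * `|v|) * `|v|.
  rewrite (le_trans (smooth_diff_ler (G_smooth hA) _ _ _)) //.
  by rewrite /xt addrAC subrr add0r normrZ ger0_norm.
have k0 : 0 <= alpha1 D + alpha2 D / mu.
  by rewrite addr_ge0 ?(alpha1_ge0 hB) // divr_ge0 ?ltW ?(alpha2_gt0 hB).
have n2 : `|dual mu xt - dual mu x| <= (alpha1 D + alpha2 D / mu) * (M * (t * `|v|)).
  have := h_lipschitz hB mu0 (x := (G xt, G x)) => /= /(_ (conj I I)) h2.
  by apply: le_trans h2 _; rewrite ler_wpM2l.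
have n3 : `|'d G x v| <= M * `|v|.
  rewrite (le_trans (diff_opnorm_ler _ (G_differentiable _))) // ler_wpM2r //.
  by have := hM 0; rewrite scale0r addr0 lexx ler01; apply.
rewrite dot_grad_g //.
have -> : dot ('d G xt v) (dual mu xt) - dot ('d G x v) (dual mu x)
    = dot ('d G xt v - 'd G x v) (dual mu xt) + dot ('d G x v) (dual mu xt - dual mu x).
  by rewrite dotBl dotBr addrA subrK.
have CE : C * `|v| ^+ 2 * t = L_G D * (t * `|v|) * `|v| * M_B D
  + (M * `|v|) * ((alpha1 D + alpha2 D / mu) * (M * (t * `|v|))).
  by rewrite /C; field; rewrite gt_eqF.
rewrite [leRHS]CE; apply: lerD; rewrite (le_trans (dot_le _ _)) // ler_pM //; exact: norm_dual.
Qed.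

Hypothesis hD : convex_assumption D.

(** Subtracting [w] in the cone cannot decrease [h_mu], whose gradient is a polar vector; this
    absorbs the defect [w] in the convexity of [G]. *)
Lemma g_convex mu : 0 < mu -> convex_function setT (g_ D mu).
Proof.
move=> mu0; apply: convex_functionI => x z t t01.
have [w Kw E] := G_convex hD x z t01.
have hc := convex_functionE (h_convex hB mu0) (G x) (G z) t01.
rewrite E in hc; apply: le_trans hc; rewrite /g_; set p := t *: x + _.
have := h_gradient_le p (G p - w) mu0; rewrite addrAC subrr add0r dotNr.
have := base_sub_polar (dual_mem p mu0) Kw; lra.
Qed.

(** A feasible [z] may violate the smoothed constraint, but by no more than the smoothing error;
    convexity passes this bound to the linearization. *)
Lemma g_linearization_le mu x z : 0 < mu -> feasible D z ->
  g_ D mu x + dot (grad (g_ D mu) x) (z - x) <= alpha3 D * mu.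
Proof.
move=> mu0 fz; have [dg _] := g_diff x mu0.
have := convex_gradient_le (g_convex mu0) z dg; rewrite gradP.
have /andP[_] := g_approx z mu0; have := g_B_le0 fz; lra.
Qed.

End Constraint.

(** The case without a supremum is covered by the convention that [sup] is then 0. *)
Lemma sup_ge0 (R : realType) (S : set R) : (forall x, S x -> 0 <= x) -> 0 <= sup S.
Proof.
move=> S0; have [[[x Sx] ub]|/sup_out -> //] := pselect (has_sup S).
exact: le_trans (S0 x Sx) (ub_le_sup ub Sx).
Qed.

Lemma convex_setI (R : realType) (X : euclideanType R) (A : set X) :
  (forall x y (t : R), A x -> A y -> 0 <= t <= 1 -> A (t *: x + (1 - t) *: y)) ->
  convex_set A.
Proof.
move=> h x y t; rewrite !inE => Ax Ay.
by apply: h => //; rewrite ge0 le1.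
Qed.

Lemma convex_hull_norm_le (R : realType) (X : euclideanType R) (A : set X) (M : R) :
  (forall x, A x -> `|x| <= M) -> forall x, convex_hull A x -> `|x| <= M.
Proof.
move=> hM; apply: (@smallest_sub _ (@convex_set R X) A [set x | `|x| <= M]) => //.
apply: convex_setI => y z t /= yM zM /andP[t0 t1].
rewrite (le_trans (ler_normD _ _)) // !normrZ !ger0_norm ?subr_ge0 //.
have -> : M = t * M + (1 - t) * M by ring.
by rewrite lerD // ler_wpM2l // subr_ge0.
Qed.

(** * Finiteness of the suprema and infima that define the constants *)

Section Constants.
Context {R : realType} {X Y : euclideanType R} (D : smba_data X Y).
Hypothesis hA : problem_assumption D.
Hypothesis hbase : compact_base D.

Local Notation G := (con_G D).

Lemma Omega0_init : Omega0 D (init_x D).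
Proof. by split => //; exact: (interior_subset (x0_slater hA)). Qed.

Lemma M_G_ge0 : 0 <= M_G D.
Proof.
by apply: sup_ge0 => _ [x _ <-]; exact/diff_opnorm_ge0/(G_differentiable hA).
Qed.

Lemma opnorm_le_M_G x : Omega0 D x -> opnorm ('d G x) <= M_G D.
Proof.
move=> Ox; have [M hM] := smooth_opnorm_bounded (G_smooth hA) (L_G_ge0 hA) (Omega0_bounded hA).
by apply: ub_le_sup; [exists M => _ [z Oz <-]; exact: hM|exists x].
Qed.

Lemma Omega0_norm_le : exists M : R, forall x, Omega0 D x -> `|x| <= M.
Proof. by apply/bounded_setP; exact: Omega0_bounded hA. Qed.

Lemma Omega0_hat_norm_le mu : exists M : R, forall x, Omega0_hat D mu x -> `|x| <= M.
Proof.
have [M hM] := Omega0_norm_le; exists (M + M_R D mu) => _ [x Ox [v /= hv <-]].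
by rewrite (le_trans (ler_normD _ _)) // lerD // hM.
Qed.

Lemma opnorm_le_M_G_hat mu x : convex_hull (Omega0_hat D mu) x ->
  opnorm ('d G x) <= M_G_hat D mu.
Proof.
move=> Ox; have [M hM] := Omega0_hat_norm_le mu.
have bh : bounded_set (convex_hull (Omega0_hat D mu)).
  by apply/bounded_setP; exists M; exact: convex_hull_norm_le.
have [C hC] := smooth_opnorm_bounded (G_smooth hA) (L_G_ge0 hA) bh.
by apply: ub_le_sup; [exists C => _ [z Oz <-]; exact: hC|exists x].
Qed.

Lemma opnorm_segment_le mu x v t : Omega0 D x -> `|v| <= M_R D mu -> 0 <= t <= 1 ->
  opnorm ('d G (x + t *: v)) <= M_G_hat D mu.
Proof.
move=> Ox vM /andP[t0 t1]; apply: opnorm_le_M_G_hat.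
apply: (@sub_smallest _ _ (Omega0_hat D mu) (Omega0_hat D mu)) => //.
exists x => //; exists (t *: v) => //=.
rewrite normrZ ger0_norm //; apply: le_trans vM.
by rewrite -[leRHS]mul1r ler_wpM2r.
Qed.

(** The infimum is meaningful because one fixed [u] in the base bounds [g_B] from below: [G] is
    bounded on the bounded set [Omega0]. *)
Lemma g_B_inf_le x : Omega0 D x -> g_B_inf D <= g_B D x.
Proof.
move=> Ox; have [M hM] := Omega0_norm_le; have [u Bu] := base_nonempty hbase.
have bb : bounded_set [set z : X | `|z| <= M] by apply/bounded_setP; exists M.
have [C hC] := smooth_opnorm_bounded (G_smooth hA) (L_G_ge0 hA) bb.
apply: ge_inf; last by exists x.
exists (- ((C * M + `|G 0|) * `|u|)) => _ [z Oz <-].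
apply: le_trans (support_ub (base_compact hbase) (G z) Bu).
rewrite lerNl -dotNl (le_trans (dot_le _ _)) // normrN ler_wpM2r //.
rewrite -lerBlDr (le_trans (lerB_dist _ _)) //.
have := @mean_value _ _ _ G 0 z (C * M) (G_differentiable hA).
rewrite add0r; apply => t /andP[t0 t1]; rewrite add0r.
have tM : `|t *: z| <= M.
  rewrite normrZ ger0_norm // (le_trans _ (hM _ Oz)) //.
  by rewrite -[leRHS]mul1r ler_wpM2r.
rewrite (le_trans (diff_opnorm_ler _ (G_differentiable hA _))) //.
by rewrite ler_pM ?hM ?hC //; exact/diff_opnorm_ge0/(G_differentiable hA).
Qed.

Lemma norm_grad_f_le x : Omega0 D x -> `|grad (obj_f D) x| <= M_f D.
Proof.
move=> Ox; have [df _] := f_smooth hA.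
have [M hM] := smooth_opnorm_bounded (f_smooth hA) (ltW (L_f_gt0 hA)) (Omega0_bounded hA).
apply: ub_le_sup; last by exists x.
exists M => _ [z Oz <-]; apply: le_trans (hM z Oz).
apply: norm_le_dot => [|v]; first exact: diff_opnorm_ge0.
by rewrite gradP (le_trans (ler_norm _)) // (diff_opnorm_ler (F := obj_f D : X -> R^o)).
Qed.

Lemma M_f_ge0 : 0 <= M_f D. Proof. by apply: sup_ge0 => _ [x _ <-]. Qed.

Lemma M_P1_ge0 mu : 0 <= M_P1 D mu. Proof. by apply: sup_ge0 => _ [x _ <-]. Qed.

Lemma M_P2_ge0 : 0 <= M_P2 D. Proof. by apply: sup_ge0 => _ [x _ <-]. Qed.

Lemma norm_subdiff_P1_le mu x z : Omega0_hat D mu x -> subdiff (obj_P1 D) x z ->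
  `|z| <= M_P1 D mu.
Proof.
move=> Ox dz.
have bh : bounded_set (Omega0_hat D mu) by apply/bounded_setP; exact: Omega0_hat_norm_le.
have [C hC] := subdiff_bounded (P1_convex hA) bh.
apply: ub_le_sup; last by exists z => //; exists x.
by exists C => _ [w [y Oy dw] <-]; exact: hC dw.
Qed.

Lemma dist_le_diam x y : Omega0 D x -> Omega0 D y -> `|x - y| <= diam_Omega0 D.
Proof.
move=> Ox Oy; have [M hM] := Omega0_norm_le.
apply: ub_le_sup; last by exists x => //; exists y.
by exists (M + M) => _ [u Ou [w Ow <-]]; rewrite (le_trans (ler_normB _ _)) // lerD ?hM.
Qed.

End Constants.

(** * One step of the algorithm *)

Lemma lagrangian_identity (R : realType) (p a b c d e m n lam : R) : m != 0 ->
  p + a + d / 2 * n + lam * (c + b + e / (2 * m) * n) =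
  p + (a + lam * b) + (d + lam * e / m) / 2 * n + lam * c.
Proof. by move=> m0; field. Qed.

Section Run.
Context {R : realType} {X Y : euclideanType R} (D : smba_data X Y) (T : smba_trace X).
Hypothesis hA : problem_assumption D.
Hypothesis hbase : compact_base D.
Hypothesis hB : smoothing_assumption D.
Hypothesis hD : convex_assumption D.
Hypothesis hrun : smba_run D T.

Local Notation G := (con_G D).
Local Notation mu := (mu_ T).
Local Notation x := (x_ T).
Local Notation Lf k i := (2 ^+ i * L_f0_ T k).
Local Notation Lg k j := (2 ^+ j * L_g0_ T k).

Lemma run_mu_gt0 k : 0 < mu k.
Proof. by case: k => [|k]; [exact: run_mu0_gt0 hrun|have /andP[] := run_mu hrun k]. Qed.

Lemma run_mu_decr k : mu k.+1 < mu k.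
Proof. by have /andP[] := run_mu hrun k. Qed.

Lemma run_mu_le m n : (m <= n)%N -> mu n <= mu m.
Proof.
by move=> mn; rewrite -(subnK mn); elim: (n - m)%N => // d; apply: le_trans; exact/ltW/run_mu_decr.
Qed.

Lemma psiE y : psi D y = obj_f D y + obj_P1 D y.
Proof. by rewrite /psi (P2_eq0 hD) subr0. Qed.

Lemma run_xi_eq0 k : xi_ T k = 0.
Proof.
have := run_xi hrun k (x k + xi_ T k).
rewrite !(P2_eq0 hD) add0r addrAC subrr add0r dotxx => h.
by apply/eqP; rewrite -normr_eq0 -sqrf_eq0 eq_le h sqr_ge0.
Qed.

Lemma Lf_ge k i : L_check D <= Lf k i.
Proof.
have /andP[h _] := run_L_f0 hrun k; have Lc := L_check_gt0 hrun.
by rewrite (le_trans h) // ler_peMl ?exprn_ege1 ?ler1n // (le_trans (ltW Lc)).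
Qed.

Lemma Lg_ge k j : L_check D <= Lg k j.
Proof.
have /andP[h _] := run_L_g0 hrun k; have Lc := L_check_gt0 hrun.
by rewrite (le_trans h) // ler_peMl ?exprn_ege1 ?ler1n // (le_trans (ltW Lc)).
Qed.

Lemma Lg_gt0 k j : 0 < Lg k j.
Proof. exact: lt_le_trans (L_check_gt0 hrun) (Lg_ge k j). Qed.

Definition model_grad k lam := grad (obj_f D) (x k) + lam *: grad (g_ D (mu k)) (x k).

Definition model_modulus k i j lam := Lf k i + lam * Lg k j / mu k.

Lemma lagrangianE k i j lam y :
  sub_obj D T k i y + lam * sub_con D T k j y =
  prox_model (obj_P1 D) (x k) (model_grad k lam) (model_modulus k i j lam) y
    + lam * g_ D (mu k) (x k).
Proof.
rewrite /sub_obj /sub_con /prox_model /model_grad /model_modulus run_xi_eq0 subr0.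
rewrite dotDl.
rewrite dotZl.
apply: lagrangian_identity.
by rewrite gt_eqF // run_mu_gt0.
Qed.

Lemma sub_objE k i y : sub_obj D T k i y = obj_P1 D y
  + dot (grad (obj_f D) (x k)) (y - x k) + Lf k i / 2 * `|y - x k| ^+ 2.
Proof. by rewrite /sub_obj run_xi_eq0 subr0. Qed.

Lemma sub_obj_center k i : sub_obj D T k i (x k) = obj_P1 D (x k).
Proof. by rewrite /sub_obj subrr dot0r normr0 expr0n /= mulr0 !addr0. Qed.

Lemma sub_con_center k j : sub_con D T k j (x k) = g_ D (mu k) (x k).
Proof. by rewrite /sub_con subrr dot0r normr0 expr0n /= mulr0 !addr0. Qed.

(** * Trial points of the inner loop *)

Section Visited.
Context (k i j : nat).
Hypothesis vis : visited D T k i j.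
Local Notation xs := (sub_x T k i j).
Local Notation lam := (sub_lam T k i j).

Lemma sub_lam_ge0 : 0 <= lam.
Proof. by have [_ []] := run_sub hrun vis. Qed.

Lemma sub_con_le0 : sub_con D T k j xs <= 0.
Proof. by have [[]] := run_sub hrun vis. Qed.

Lemma sub_complementary : lam * sub_con D T k j xs = 0.
Proof. by have [_ []] := run_sub hrun vis. Qed.

Lemma sub_prox y :
  prox_model (obj_P1 D) (x k) (model_grad k lam) (model_modulus k i j lam) xs <=
  prox_model (obj_P1 D) (x k) (model_grad k lam) (model_modulus k i j lam) y.
Proof.
have [_ [_ _ [_ h]]] := run_sub hrun vis.
by have := h y I; rewrite !lagrangianE lerD2r.
Qed.

Lemma sub_three_point z :
  sub_obj D T k i xs + model_modulus k i j lam / 2 * `|z - xs| ^+ 2 <=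
  sub_obj D T k i z + lam * sub_con D T k j z.
Proof.
have := prox_three_point (P1_convex hA) z sub_prox.
have := lagrangianE k i j lam xs; rewrite sub_complementary addr0 => ->.
by rewrite lagrangianE; lra.
Qed.

(** The three-point inequality is taken at the centre [x k], where the multiplier term is
    nonpositive. [Lf] enters with full weight: one half comes from the model, the other from its
    quadratic growth. *)
Lemma sub_descent : g_ D (mu k) (x k) <= 0 ->
  psi D xs <= psi D (x k)
    + (L_f D / 2 - Lf k i - lam * Lg k j / (2 * mu k)) * `|xs - x k| ^+ 2.
Proof.
move=> gx; have := sub_three_point (x k).
have := smooth_quadratic_bound (x k) xs (f_smooth hA).
rewrite !psiE sub_obj_center sub_con_center sub_objE (distrC (x k)) /model_modulus.
have := mulr_ge0_le0 sub_lam_ge0 gx.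
set N := `|_| ^+ 2.
have -> : lam * Lg k j / (2 * mu k) = (lam * Lg k j / mu k) / 2.
  by move: (Lg k j) (mu k) (run_mu_gt0 k) => b m m0; field; rewrite gt_eqF.
move: (Lf k i) (lam * Lg k j / mu k) => a b; lra.
Qed.

Hypothesis Ox : Omega0 D (x k).

(** The model constraint yields [d^2 <= 2 * a * (N * d - g_B_inf)] with [a = mu_0 / L_check] and
    [N = M_G * M_B]; [M_R] is the larger root of the corresponding equation. *)
Lemma displacement_le : `|xs - x k| <= M_R D mu.
Proof.
set d := `|xs - x k|; have d0 : 0 <= d by exact: normr_ge0.
have mu0 := run_mu_gt0 k; have Lc := L_check_gt0 hrun; have Lg0 := Lg_gt0 k j.
have N0 : `|grad (g_ D (mu k)) (x k)| <= M_G D * M_B D.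
  rewrite (le_trans (norm_grad_g hA hbase hB _ mu0)) // ler_wpM2r ?(M_B_ge0 hbase) //.
  exact: opnorm_le_M_G.
have gk : g_B_inf D <= g_ D (mu k) (x k).
  have /andP[h _] := g_approx hB (x k) mu0; apply: le_trans h.
  exact: (g_B_inf_le hA hbase).
set N := M_G D * M_B D in N0.
have hd : Lg k j / (2 * mu k) * d ^+ 2 <= N * d - g_B_inf D.
  have := sub_con_le0; rewrite /sub_con -/d.
  have := dot_le (- grad (g_ D (mu k)) (x k)) (xs - x k); rewrite normrN dotNl -/d.
  have := ler_wpM2r d0 N0; lra.
pose a := mu 0%N * (L_check D)^-1.
have a0 : 0 < a by rewrite mulr_gt0 ?invr_gt0 ?run_mu_gt0.
have {}hd : d ^+ 2 <= 2 * a * (N * d - g_B_inf D).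
  have k1 : (2 * a)^-1 <= Lg k j / (2 * mu k).
    have m0 := run_mu_gt0 0.
    have -> : (2 * a)^-1 = L_check D / (2 * mu 0%N).
      by rewrite /a; field; rewrite !gt_eqF.
    apply: ler_pM; [exact: ltW|by rewrite invr_ge0 mulr_ge0 // ltW|exact: Lg_ge|].
    by rewrite lef_pV2 ?posrE ?mulr_gt0 // ler_pM2l // run_mu_le.
  have a2 : 0 < 2 * a by apply: mulr_gt0.
  rewrite -ler_pdivrMl //; apply: le_trans hd.
  by rewrite ler_wpM2r ?sqr_ge0.
rewrite /M_R.
have -> : mu 0%N ^+ 2 * L_check D ^- 2 * M_G D ^+ 2 * M_B D ^+ 2
   - 2 * mu 0%N / L_check D * g_B_inf D = (a * N) ^+ 2 - 2 * a * g_B_inf D.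
  by rewrite /a /N; field; rewrite gt_eqF.
rewrite -[_ * M_G D * M_B D]mulrA -/a -/N -lerBlDr.
rewrite (le_trans (ler_norm _)) // -sqrtr_sqr ler_wsqrtr //; nra.
Qed.

(** Multiplication by [mu] turns the singular [alpha2 / mu] term into a constant, so the product is
    nondecreasing in [mu]. *)
Lemma mu_L_smooth_le : mu k * L_smooth D mu (mu k) <= mu 0%N * L_smooth D mu (mu 0%N).
Proof.
have mk := run_mu_gt0 k; have m0 := run_mu_gt0 0.
rewrite /L_smooth !mulrDr !(mulrCA (mu _) (_ * _)) !divff ?gt_eqF // lerD2r lerD //.
  rewrite ler_wpM2r ?run_mu_le // mulr_ge0 ?(M_B_ge0 hbase) ?(L_G_ge0 hA) //.
by rewrite ler_wpM2r ?run_mu_le // mulr_ge0 ?sqr_ge0 ?(alpha1_ge0 hB).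
Qed.

(** If [Lg] exceeded [mu_k * L_smooth], the model would dominate [g_mu] at the trial point, and a
    nonpositive model value would exclude infeasibility. *)
Lemma infeasible_bound : 0 < g_ D (mu k) xs ->
  2 ^+ j * L_check D <= mu 0%N * L_smooth D mu (mu 0%N).
Proof.
move=> gpos; have mk := run_mu_gt0 k.
have /andP[L0 _] := run_L_g0 hrun k.
have := @g_quadratic_bound _ _ _ D hA hbase hB (mu k) (x k) (xs - x k) (M_G_hat D mu) mk.
rewrite (addrC (x k) (xs - x k)) subrK => /(_ (fun t => opnorm_segment_le hA Ox displacement_le)).
rewrite -/(L_smooth D mu (mu k)) => hq.
have := sub_con_le0; rewrite /sub_con => hs.
apply: le_trans mu_L_smooth_le.
apply: (@le_trans _ _ (Lg k j)); first by rewrite ler_pM2l ?exprn_gt0.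
rewrite leNgt; apply/negP => hL.
suff : L_smooth D mu (mu k) / 2 <= Lg k j / (2 * mu k).
  by have := sqr_ge0 `|xs - x k|; nra.
have -> : Lg k j / (2 * mu k) = Lg k j / mu k / 2 by rewrite invfM mulrA mulrAC.
rewrite ler_pM2r ?invr_gt0 // ler_pdivlMr // mulrC.
exact: ltW.
Qed.

(** Above both thresholds the decrease from [sub_descent] is at least the one demanded by
    [accepted]. *)
Lemma no_descent_bound : g_ D (mu k) (x k) <= 0 -> ~ accepted D T k i j ->
  ~ 0 < g_ D (mu k) xs ->
  2 ^+ i * L_check D <= L_f D + tau1 D \/ 2 ^+ j * L_check D <= tau2 D.
Proof.
move=> gx nacc /negP; rewrite -leNgt => gs.
have [|hi] := leP (2 ^+ i * L_check D) (L_f D + tau1 D); first by left.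
have [|hj] := leP (2 ^+ j * L_check D) (tau2 D); first by right.
exfalso; apply: nacc; split => //; apply: le_trans (sub_descent gx) _.
rewrite lerD2l -[leRHS]mulNr ler_wpM2r ?sqr_ge0 //.
have /andP[L0 _] := run_L_g0 hrun k; have /andP[L1 _] := run_L_f0 hrun k.
have hi' : L_f D + tau1 D <= Lf k i by rewrite (le_trans (ltW hi)) // ler_pM2l ?exprn_gt0.
have hj' : tau2 D <= Lg k j by rewrite (le_trans (ltW hj)) // ler_pM2l ?exprn_gt0.
have mk := run_mu_gt0 k.
have -> : (tau1 D * mu k + tau2 D * lam) / (2 * mu k) = tau1 D / 2 + lam * tau2 D / (2 * mu k).
  by move: (mu k) mk => m m0; field; rewrite gt_eqF.
have : lam * tau2 D / (2 * mu k) <= lam * Lg k j / (2 * mu k).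
  by rewrite ler_pM2r ?invr_gt0 ?mulr_gt0 // ler_wpM2l // sub_lam_ge0.
have := L_f_gt0 hA; have := tau1_gt0 hrun; lra.
Qed.

End Visited.
End Run.

(** * Termination bounds, feasibility of the iterates and nondegeneracy of the constraint *)

Section Multipliers.
Context {R : realType} {X Y : euclideanType R} (D : smba_data X Y) (T : smba_trace X).
Hypothesis hA : problem_assumption D.
Hypothesis hbase : compact_base D.
Hypothesis hB : smoothing_assumption D.
Hypothesis hD : convex_assumption D.
Hypothesis hrun : smba_run D T.

Local Notation G := (con_G D).
Local Notation mu := (mu_ T).
Local Notation x := (x_ T).
Local Notation Lf k i := (2 ^+ i * L_f0_ T k).
Local Notation Lg k j := (2 ^+ j * L_g0_ T k).
Local Notation mu_gt0 := (run_mu_gt0 hrun).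

Local Notation objective_factor := (Num.max 2 (2 * (L_f D + tau1 D) / L_check D)).
Local Notation constraint_factor := (Num.max 2 (Num.max (2 * tau2 D / L_check D)
  (2 * mu 0%N * L_smooth D mu (mu 0%N) / L_check D))).

(* A step of the inner loop occurs only while 2^j is small compared with the
   constraint factor or 2^i is small compared with the objective factor; steps
   of the second kind increase i and j together. *)
Lemma visited_invariant k i j : Omega0 D (x k) -> g_ D (mu k) (x k) <= 0 ->
  visited D T k i j -> (i <= j)%N /\
  (2 ^+ j <= constraint_factor \/
   2 ^+ j <= constraint_factor * 2 ^+ i /\ 2 ^+ i <= objective_factor).
Proof.
move=> Ox gx; set A := objective_factor; set B := constraint_factor.
have Lc := L_check_gt0 hrun.
have B2 : 2 <= B by rewrite le_max lexx.
have A2 : 2 <= A by rewrite le_max lexx.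
have step (a c : R) n : 2 ^+ n * L_check D <= a -> 2 * a / L_check D <= c -> 2 ^+ n.+1 <= c.
  move=> h; apply: le_trans; rewrite ler_pdivlMr // exprS -mulrA ler_pM2l //.
have leB1 : 2 * tau2 D / L_check D <= B by rewrite !le_max lexx !orbT.
have leB2 : 2 * (mu 0%N * L_smooth D mu (mu 0%N)) / L_check D <= B.
  by rewrite mulrA !le_max lexx !orbT.
have leA : 2 * (L_f D + tau1 D) / L_check D <= A by rewrite le_max lexx orbT.
have B0 : 0 < B by exact: lt_le_trans B2.
have weaken (p q : nat) : 2 ^+ p <= B \/ 2 ^+ p <= B * 2 ^+ q /\ 2 ^+ q <= A ->
    2 ^+ p <= B * 2 ^+ q :> R.
  case=> [h|[]//]; apply: le_trans h _.
  by rewrite ler_peMr ?exprn_ege1 ?ler1n // ltW.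
elim=> {i j} [|i j vis [ij IH] _ gpos|i j vis [ij IH] nacc ngpos].
- by split => //; left; rewrite expr0; lra.
- split; first exact: leqW.
  by left; exact: step (infeasible_bound hA hbase hB hrun vis Ox gpos) leB2.
- split => //.
  have [hi|hj] := no_descent_bound hA hD hrun vis gx nacc ngpos; last first.
    by left; exact: step hj leB1.
  right; split; last exact: step hi leA.
  by rewrite !exprS mulrCA ler_pM2l // weaken.
Qed.

(** [M_L] is [L_hat] times the product of the two factors. That product bounds [2 ^+ j], and
    [i <= j] extends the bound to [2 ^+ i]. *)
Lemma visited_factor_le k i j : Omega0 D (x k) -> g_ D (mu k) (x k) <= 0 ->
  visited D T k i j -> Lf k i <= M_L D mu /\ Lg k j <= M_L D mu.
Proof.
move=> Ox gx /(visited_invariant Ox gx) [ij h].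
have A2 : 2 <= objective_factor by rewrite le_max lexx.
have B2 : 2 <= constraint_factor by rewrite le_max lexx.
have jle : 2 ^+ j <= objective_factor * constraint_factor.
  move: A2 B2 h; set A := objective_factor; set B := constraint_factor.
  move=> A2 B2 [h|[h1 h2]]; first by nra.
  by apply: le_trans h1 _; rewrite mulrC ler_wpM2r //; lra.
have ile : 2 ^+ i <= objective_factor * constraint_factor.
  by apply: le_trans jle; rewrite ler_eXn2l // ltr1n.
have Lc := L_check_gt0 hrun.
have /andP[f0 f1] := run_L_f0 hrun k; have /andP[g0 g1] := run_L_g0 hrun k.
by split; rewrite mulrC /M_L -mulrA ler_pM ?exprn_ge0 // (le_trans (ltW Lc)).
Qed.

Lemma M_L_gt0 : 0 < M_L D mu.
Proof.
have Lh : 0 < L_hat D := lt_le_trans (L_check_gt0 hrun) (L_check_hat hrun).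
by rewrite /M_L !mulr_gt0 // lt_max ltr0n.
Qed.

Lemma tau_term_ge0 k i j : visited D T k i j ->
  tau1 D / 2 <= (tau1 D * mu k + tau2 D * sub_lam T k i j) / (2 * mu k).
Proof.
move=> vis; have l0 := sub_lam_ge0 hrun vis; have m0 := mu_gt0 k.
rewrite ler_pdivlMr ?mulr_gt0 // -mulrA mulKf ?pnatr_eq0 //.
by rewrite lerDl mulr_ge0 // ltW // (tau2_gt0 hrun).
Qed.

Lemma iterate_descent k :
  psi D (x k.+1) + tau1 D / 2 * `|x k.+1 - x k| ^+ 2 <= psi D (x k).
Proof.
have [_ h] := run_accepted hrun k; rewrite (run_next hrun).
have := tau_term_ge0 (run_visited hrun k).
have := sqr_ge0 `|sub_x T k (i_ T k) (j_ T k) - x k|; move: h.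
move: (psi _ _) (psi _ _) (_ / (2 * mu k)) (_ ^+ 2) => a b c d *; nra.
Qed.

Lemma psi_decr k : psi D (x k.+1) <= psi D (x k).
Proof.
apply: le_trans (iterate_descent k); rewrite lerDl mulr_ge0 ?sqr_ge0 //.
by rewrite divr_ge0 // ltW // (tau1_gt0 hrun).
Qed.

Lemma g_next_le0 k : g_ D (mu k) (x k.+1) <= 0.
Proof. by have [h _] := run_accepted hrun k; rewrite (run_next hrun). Qed.

(** Passing from [mu k] to [mu k.+1] creates slack in a constraint that was only nonstrictly
    satisfied; this slack serves the indices before [t_bar]. *)
Lemma g_iterate_le k :
  g_ D (mu k.+1) (x k.+1) <= - (alpha4 D * (mu k - mu k.+1)).
Proof.
have := h_decr hB (G (x k.+1)) (mu_gt0 k.+1) (run_mu_decr hrun k).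
have := g_next_le0 k; rewrite /g_; lra.
Qed.

Lemma g_iterate_le0 k : g_ D (mu k) (x k) <= 0.
Proof.
case: k => [|k]; first by rewrite (run_x0 hrun) ltW // (run_mu0 hrun).
apply: le_trans (g_iterate_le k) _; rewrite oppr_le0 mulr_ge0 ?subr_ge0 //.
  exact/ltW/(alpha4_gt0 hB).
exact/ltW/(run_mu_decr hrun).
Qed.

Lemma iterate_Omega0 k : Omega0 D (x k).
Proof.
elim: k => [|k [psik _]]; first by rewrite (run_x0 hrun); exact: Omega0_init.
split; first exact: le_trans (psi_decr k) psik.
exact: (feasible_g hA hbase hB (mu_gt0 k) (g_next_le0 k)).
Qed.

Section Eta.
Context (eta : R).
Hypothesis hC : stepsize_assumption mu.
Hypothesis heta : eta_valid D eta.

Lemma t_barP : (0 < t_bar D mu eta)%N /\ mu (t_bar D mu eta) < eta / (2 * alpha3 D).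
Proof.
have [eta0 _] := heta.
have e0 : 0 < eta / (2 * alpha3 D) by rewrite divr_gt0 // mulr_gt0 // (alpha3_gt0 hB).
pose P (t : nat) := (0 < t)%N && (mu t < eta / (2 * alpha3 D)).
have exP : exists t, P t.
  have /cvgrPdist_lt/(_ _ e0)[N _ hN] := mu_cvg0 hC.
  (* The successor is taken because [t_bar] has to be positive. *)
  exists N.+1; rewrite /P /=; have := hN N.+1 (leqnSn N); rewrite /= sub0r normrN.
  by apply: le_lt_trans; exact: ler_norm.
case: (ex_minnP exP) => t /andP[t0 tlt] tmin.
have [|] := @getI _ [set t : nat | [/\ (0 < t)%N, mu t < eta / (2 * alpha3 D) &
    forall s, (0 < s < t)%N -> ~ mu s < eta / (2 * alpha3 D)]] t.
  split => // s /andP[s0 st] sl; have := tmin s; rewrite /P s0 sl => /(_ isT).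
  by rewrite leqNgt st.
by move=> ? ? _; split.
Qed.

Lemma stepsize_ratio_gt0 t : (0 < t)%N -> 0 < mu t.-1 / mu t - 1.
Proof.
by case: t => // t _; rewrite subr_gt0 ltr_pdivlMr ?mu_gt0 // mul1r; exact: (run_mu_decr hrun).
Qed.

Lemma c_0_gt0 : 0 < c_0 D mu eta.
Proof.
rewrite /c_0 big_nat_cond; apply: lt_bigmin => [|t /andP[/andP[t0 _] _]].
  exact: (@stepsize_ratio_gt0 1).
exact: stepsize_ratio_gt0.
Qed.

Lemma c_0_le t : (0 < t <= t_bar D mu eta)%N -> c_0 D mu eta <= mu t.-1 / mu t - 1.
Proof.
move=> t1; apply: (@ge_bigmin_seq _ _ _ _ _ t xpredT (fun t => mu t.-1 / mu t - 1)) => //.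
by rewrite mem_index_iota ltnS.
Qed.

Let eta_min := Num.min eta (Num.min (2 * alpha3 D * L_check D)
    (Num.min (- 2 * (mu 0%N)^-1 * L_check D * g_ D (mu 0%N) (init_x D))
             (2 * c_0 D mu eta * alpha4 D * L_check D))).

Lemma eta_min_gt0 : 0 < eta_min.
Proof.
have Lc := L_check_gt0 hrun; have [eta0 _] := heta.
have m0 := mu_gt0 0; have a3 := alpha3_gt0 hB; have a4 := alpha4_gt0 hB.
have c0 := c_0_gt0; have g0 := run_mu0 hrun.
rewrite !lt_min eta0 /=; apply/and3P; split; [by rewrite !mulr_gt0| |by rewrite !mulr_gt0].
by rewrite nmulr_lgt0 // !mulNr oppr_lt0 !mulr_gt0 // invr_gt0.
Qed.

Lemma eta_bar_sqr : eta_bar D mu eta ^+ 2 = eta_min.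
Proof. by rewrite sqr_sqrtr // ltW // eta_min_gt0. Qed.

Lemma eta_bar_gt0 : 0 < eta_bar D mu eta.
Proof. by rewrite sqrtr_gt0; exact: eta_min_gt0. Qed.

(* If the gradient is small, the choice of eta bounds - <u, G(x)> from below,
   which controls - g_mu once alpha_3 mu < eta / 2, that is for k >= t_bar; before
   that, - g_mu is bounded below by the decrease of h in mu. *)
Lemma eta_bar_sqr_le k (L : R) : L_check D <= L ->
  eta_bar D mu eta ^+ 2 <=
  `|grad (g_ D (mu k)) (x k)| ^+ 2 - 2 * (L / mu k) * g_ D (mu k) (x k).
Proof.
move=> hL; have Lc := L_check_gt0 hrun; have mk := mu_gt0 k.
have gk := g_iterate_le0 k; set g := g_ _ _ _ in gk *.
set N := `|_|; have N2 : 0 <= N ^+ 2 by exact: sqr_ge0.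
have gL : 2 * (L_check D / mu k) * - g <= 2 * (L / mu k) * - g.
  rewrite ler_wpM2r ?oppr_ge0 // ler_pM2l // ler_pM2r // invr_gt0 //.
rewrite eta_bar_sqr.
have [m1 m2 m3 m4] : [/\ eta_min <= eta, eta_min <= 2 * alpha3 D * L_check D,
   eta_min <= - 2 * (mu 0%N)^-1 * L_check D * g_ D (mu 0%N) (init_x D) &
   eta_min <= 2 * c_0 D mu eta * alpha4 D * L_check D].
  by split; rewrite /eta_min !ge_min lexx ?orbT.
have [gN|gN] := ltP eta (N ^+ 2).
  have : 0 <= 2 * (L / mu k) * - g.
    by rewrite mulr_ge0 ?oppr_ge0 // mulr_ge0 // divr_ge0 ?ltW // (lt_le_trans Lc).
  by move: (2 * (L / mu k)) m1 gN => ? ? ?; lra.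
suff : eta_min <= 2 * (L_check D / mu k) * - g by move: N2 gL; rewrite !mulrN; lra.
have ug : eta < - dot (grad (smooth_h D (mu k)) (G (x k))) (G (x k)).
  have [_ nex] := heta; rewrite ltNge; apply/negP => h; apply: nex.
  exists (x k), (grad (smooth_h D (mu k)) (G (x k))); split => //.
  - exact: iterate_Omega0.
  - exact: dual_mem.
  - by rewrite -grad_g_adjoint.
have gu := g_le_dual hbase hB (x k) mk; rewrite -/g in gu.
have a3 := alpha3_gt0 hB; have a4 := alpha4_gt0 hB.
have [kt|tk] := ltnP k (t_bar D mu eta); last first.
  have [_ tb] := t_barP.
  have : mu k < eta / (2 * alpha3 D) by apply: le_lt_trans tb; exact: (run_mu_le hrun).
  rewrite ltr_pdivlMr ?mulr_gt0 // => mke.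
  have gm : alpha3 D * mu k <= - g by lra.
  apply: le_trans m2 _.
  have -> : 2 * alpha3 D * L_check D = 2 * (L_check D / mu k) * (alpha3 D * mu k).
    by move: (mu k) mk => m m0; field; rewrite gt_eqF.
  by rewrite ler_wpM2l // mulr_ge0 // divr_ge0 // ltW.
case: k => [|k] in g mk gk N N2 gL gN gu ug kt *.
  apply: le_trans m3 _; rewrite /g (run_x0 hrun).
  move: (g_ _ _ _) => a; move: (mu 0%N) mk => m m0.
  have -> : - 2 * m^-1 * L_check D * a = 2 * (L_check D / m) * - a by field; rewrite gt_eqF.
  exact: lexx.
apply: le_trans m4 _.
have ck : c_0 D mu eta <= mu k / mu k.+1 - 1 by apply: (@c_0_le k.+1); exact: ltnW.
have gk' : alpha4 D * (mu k - mu k.+1) <= - g by rewrite lerNr; exact: g_iterate_le.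
apply: (@le_trans _ _ (2 * (mu k / mu k.+1 - 1) * alpha4 D * L_check D)).
  by rewrite ler_pM2r // ler_pM2r // ler_pM2l.
have -> : 2 * (mu k / mu k.+1 - 1) * alpha4 D * L_check D =
   2 * (L_check D / mu k.+1) * (alpha4 D * (mu k - mu k.+1)).
  by move: (mu k) (mu k.+1) mk => m' m m0; field; rewrite gt_eqF.
by rewrite ler_wpM2l // mulr_ge0 // divr_ge0 // ltW.
Qed.

End Eta.
End Multipliers.

(** * Uniform bound on the multipliers *)

Lemma completed_square_le (R : realType) (c d n l m : R) : 0 < l -> 0 < m -> - c <= d * n ->
  - c - l / m * n ^+ 2 <= m * d ^+ 2 / (4 * l).
Proof.
move=> l0 m0 h.
(* The right-hand side is the maximum over [n] of the concave quadratic on the left, and the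
   difference is a multiple of a square. *)
have h2 : d * n - l / m * n ^+ 2 <= m * d ^+ 2 / (4 * l).
  rewrite -subr_ge0 (_ : _ - _ = m / l * (d / 2 - l / m * n) ^+ 2).
    by rewrite mulr_ge0 ?sqr_ge0 // divr_ge0 // ltW.
  by field; rewrite !gt_eqF.
lra.
Qed.

Section Convergence.
Context {R : realType} {X Y : euclideanType R} (D : smba_data X Y) (T : smba_trace X).
Context (eta : R).
Hypothesis hA : problem_assumption D.
Hypothesis hbase : compact_base D.
Hypothesis hB : smoothing_assumption D.
Hypothesis hC : stepsize_assumption (mu_ T).
Hypothesis hD : convex_assumption D.
Hypothesis hrun : smba_run D T.
Hypothesis heta : eta_valid D eta.

Local Notation G := (con_G D).
Local Notation mu := (mu_ T).
Local Notation x := (x_ T).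
Local Notation lam k := (sub_lam T k (i_ T k) (j_ T k)).
Local Notation Lf k := (2 ^+ (i_ T k) * L_f0_ T k).
Local Notation Lg k := (2 ^+ (j_ T k) * L_g0_ T k).
Local Notation mu_gt0 := (run_mu_gt0 hrun).

Lemma M_lambda_ge0 : 0 <= M_lambda D mu eta.
Proof.
have e0 := eta_bar_gt0 hB hrun heta.
have Lc := L_check_gt0 hrun; have ML := M_L_gt0 hrun.
have m0 := mu_gt0 0; apply: addr_ge0.
  by rewrite divr_ge0 ?addr_ge0 ?M_f_ge0 ?M_P1_ge0 ?M_P2_ge0 // ltW.
move: (M_L D mu) ML => a a0.
by rewrite divr_ge0 ?mulr_ge0 ?(M_G_ge0 hA) ?(M_B_ge0 hbase) // ltW.
Qed.

(** Stationarity is paired with [v] instead of being estimated in norm, so the displacement enters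
    only through [- dot Dl v]. Dividing the resulting [lam * |v|^2 <= (M_f + M_P1) * |v| + Q] by
    [|v|^2] produces the two summands of [M_lambda]. *)
Lemma multiplier_le k : lam k <= M_lambda D mu eta.
Proof.
have vis := run_visited hrun k.
have Ox := iterate_Omega0 hA hbase hB hrun k.
have gx := g_iterate_le0 hB hrun k.
have [LfM LgM] := visited_factor_le hA hbase hB hD hrun Ox gx vis.
have l0 := sub_lam_ge0 hrun vis.
have [->|lam_neq0] := eqVneq (lam k) 0; first exact: M_lambda_ge0.
have lam_gt0 : 0 < lam k by rewrite lt_neqAle eq_sym lam_neq0.
have : sub_con D T k (j_ T k) (x k.+1) = 0.
  apply/eqP; have /eqP := sub_complementary hrun vis.
  by rewrite mulf_eq0 (negbTE lam_neq0) (run_next hrun).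
have sp := prox_subgradient (P1_convex hA) (sub_prox hD hrun vis).
have xhat : Omega0_hat D mu (x k.+1).
  exists (x k) => //; exists (x k.+1 - x k); last by rewrite addrC subrK.
  by rewrite /= (run_next hrun); exact: displacement_le.
rewrite -(run_next hrun) in sp.
have zP1 := norm_subdiff_P1_le hA xhat sp.
have Nf := norm_grad_f_le hA Ox.
have mk := mu_gt0 k; have Lc := L_check_gt0 hrun; have lg0 := Lg_gt0 hrun k (j_ T k).
have Ng : `|grad (g_ D (mu k)) (x k)| <= M_G D * M_B D.
  rewrite (le_trans (norm_grad_g hA hbase hB _ mk)) // ler_wpM2r ?(M_B_ge0 hbase) //.
  exact: opnorm_le_M_G.
have es := eta_bar_sqr_le hA hbase hB hrun hC heta k (Lg_ge hrun k (j_ T k)).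
rewrite /sub_con; set Dl := x k.+1 - x k in sp zP1 *.
set gr := grad (g_ D (mu k)) (x k) in sp zP1 Ng es *.
set gf := grad (obj_f D) (x k) in sp zP1 Nf *.
move=> con0.
(* [v] is the gradient of the constraint model at the new iterate. *)
pose v := gr + (Lg k / mu k) *: Dl.
have v2 : `|v| ^+ 2 = `|gr| ^+ 2 - 2 * (Lg k / mu k) * g_ D (mu k) (x k).
  rewrite /v normD_sqr normrZ exprMn real_normK ?num_real // dotZr.
  move: (g_ _ _ _) (dot _ _) (`|gr| ^+ 2) (`|Dl| ^+ 2) (Lg k) con0 => g d a b l.
  move: (mu k) mk => m m0 h.
  have {h} -> : d = - g - l / (2 * m) * b by rewrite -[RHS]addr0 -h; ring.
  by field; rewrite gt_eqF.
have ev : eta_bar D mu eta <= `|v|.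
  have e0 := ltW (eta_bar_gt0 hB hrun heta).
  by rewrite -(@ler_pXn2r _ 2) ?nnegrE // v2.
pose z := model_grad D T k (lam k) + model_modulus T k (i_ T k) (j_ T k) (lam k) *: Dl.
have lamv : lam k *: v = z - gf - Lf k *: Dl.
  rewrite /z /v /model_grad /model_modulus -/gf -/gr.
  move: (gr) (gf) (Dl) (lam k) (mu k) (Lf k) (Lg k) => p q d c m a b.
  by apply: dot_inj => u; rewrite !(dotDr, dotNr, dotZr); ring.
have zn : `|z| <= M_P1 D mu by rewrite -normrN.
have h1 : lam k * `|v| ^+ 2 = dot z v - dot gf v - Lf k * dot Dl v.
  by rewrite -dotxx -dotZl lamv dotBl dotBl dotZl.
(* The part of [- dot Dl v] that is quadratic in [Dl] is negative and absorbs the cross term, so no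
   bound on the displacement is used. *)
have Dv : - dot Dl v <= mu k * `|gr| ^+ 2 / (4 * Lg k).
  rewrite /v dotDr dotZr dotxx opprD.
  apply: completed_square_le => //.
  by rewrite -dotNl (le_trans (dot_le _ _)) // normrN mulrC.
have h2 : dot z v <= M_P1 D mu * `|v|.
  by rewrite (le_trans (dot_le _ _)) // ler_wpM2r.
have h3 : - dot gf v <= M_f D * `|v|.
  by rewrite -dotNl (le_trans (dot_le _ _)) // normrN ler_wpM2r.
have lf0 : 0 < Lf k := lt_le_trans Lc (Lf_ge hrun k (i_ T k)).
set N := M_G D * M_B D in Ng.
have N0 : 0 <= N by rewrite (le_trans _ Ng).
set Q := M_L D mu * M_G D ^+ 2 * M_B D ^+ 2 * mu 0%N / (2 * L_check D).
have Q0 : 0 <= Q.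
  have m0 := mu_gt0 0; rewrite /Q; move: (M_L D mu) (M_L_gt0 hrun) => a a0.
  by rewrite divr_ge0 ?mulr_ge0 ?(M_G_ge0 hA) ?(M_B_ge0 hbase) // ltW.
have h4 : - (Lf k * dot Dl v) <= Q.
  rewrite -mulrN.
  have : mu k * `|gr| ^+ 2 / (4 * Lg k) <= mu 0%N * N ^+ 2 / (2 * L_check D).
    apply: ler_pM.
    - by rewrite mulr_ge0 ?sqr_ge0 // ltW.
    - by rewrite invr_ge0 mulr_ge0 // ltW.
    - by rewrite ler_pM ?sqr_ge0 ?(ltW mk) // ?(run_mu_le hrun) // ler_pXn2r ?nnegrE.
    have : 2 * L_check D <= 4 * Lg k.
      apply: ler_pM => //; [exact: ltW|by rewrite ler_nat|exact: (Lg_ge hrun k (j_ T k))].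
    move: (Lg k) lg0 => l lg0 h.
    by rewrite lef_pV2 ?posrE ?mulr_gt0.
  move=> h5; have h6 := le_trans Dv h5.
  have q0 : 0 <= mu 0%N * N ^+ 2 / (2 * L_check D).
    have m0 := mu_gt0 0; apply: divr_ge0; last by rewrite mulr_ge0 // ltW.
    by apply: mulr_ge0; [exact: ltW|exact: sqr_ge0].
  apply: (@le_trans _ _ (M_L D mu * (mu 0%N * N ^+ 2 / (2 * L_check D)))).
    apply: (@le_trans _ _ (Lf k * (mu 0%N * N ^+ 2 / (2 * L_check D)))).
      by rewrite ler_pM2l.
    by rewrite ler_wpM2r.
  rewrite /Q /N exprMn le_eqVlt; apply/orP; left; apply/eqP.
  move: (M_L D mu) (M_G D) (M_B D) (mu 0%N) => a b c d.
  by field; rewrite gt_eqF.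
have C0 : 0 <= M_f D + M_P1 D mu by rewrite addr_ge0 ?M_f_ge0 ?M_P1_ge0.
have e0 := eta_bar_gt0 hB hrun heta.
have key : lam k * `|v| ^+ 2 <= (M_f D + M_P1 D mu) * `|v| + Q.
  rewrite h1 mulrDl; apply: lerD h4; rewrite [leLHS]addrC; exact: lerD.
have -> : M_lambda D mu eta =
   (M_f D + M_P1 D mu + M_P2 D) / eta_bar D mu eta + Q / eta_bar D mu eta ^+ 2.
  by rewrite /M_lambda /Q invfM !mulrA.
have v0 : 0 < `|v| := lt_le_trans e0 ev.
have : lam k <= (M_f D + M_P1 D mu) / `|v| + Q / `|v| ^+ 2.
  rewrite -(ler_pdivlMr _ _ (exprn_gt0 2 v0)) in key; apply: le_trans key _.
  move: (M_f D + M_P1 D mu) `|v| v0 => a r r0.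
  by rewrite le_eqVlt; apply/orP; left; apply/eqP; field; rewrite gt_eqF.
move/le_trans; apply; apply: lerD.
  apply: ler_pM => //; first by rewrite lerDl M_P2_ge0.
  by rewrite lef_pV2 ?posrE.
by rewrite ler_wpM2l // lef_pV2 ?posrE ?exprn_gt0 // ler_pXn2r ?nnegrE // ltW.
Qed.

End Convergence.

(** * Rate and convergence *)

(** The descent estimate is divided by [w / 2]: [lam * L <= m * w] eliminates [lam] from the
    smoothing error, [tau / 2 * n <= p] trades the squared displacement for descent, and
    [w * m <= 2 * M] with [0 <= d] allows [2 / w] to be lowered to [m / M]. *)
Lemma weighted_step (R : realFieldType) (d lam a m LF lf w L tau n p M dist : R) :
  0 < w -> 0 < m -> 0 < M -> 0 < L -> 0 < tau -> 0 <= d -> 0 <= a -> 0 <= n -> L <= lf ->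
  L <= w -> lam * L <= m * w -> w * m <= 2 * M -> tau / 2 * n <= p ->
  d <= lam * (a * m) + (LF - lf) / 2 * n + w / 2 * dist ->
  m / M * d <= 2 * a / L * m ^+ 2 + 2 * Num.max 0 (LF - L) / (tau * L) * p + dist.
Proof.
move=> w0 m0 M0 L0 t0 d0 a0 n0 Llf Lw lamL wm tn hd.
set c := Num.max 0 (LF - L); have c0 : 0 <= c by rewrite le_max lexx.
have cL : LF - L <= c by rewrite le_max lexx orbT.
have s1 : m / M * d <= 2 / w * d.
  by rewrite ler_wpM2r // ler_pdivrMr // mulrAC ler_pdivlMr // mulrC.
have s2 : 2 / w * d <= 2 * a / L * m ^+ 2 + c / L * n + dist.
  have -> : 2 / w * d = 2 * d / w by rewrite mulrAC.
  rewrite ler_pdivrMr // !mulrDl.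
  have e1 : 2 * (lam * (a * m)) <= 2 * a / L * m ^+ 2 * w.
    have -> : 2 * a / L * m ^+ 2 * w = 2 * (a * m / L) * (m * w) by field; rewrite gt_eqF.
    have -> : 2 * (lam * (a * m)) = 2 * (a * m / L) * (lam * L) by field; rewrite gt_eqF.
    by rewrite ler_wpM2l // mulr_ge0 // divr_ge0 ?mulr_ge0 // ltW.
  have e2 : (LF - lf) * n <= c / L * n * w.
    have e3 : c <= c / L * w by rewrite mulrAC ler_pdivlMr // ler_wpM2l.
    rewrite mulrAC ler_wpM2r //; lra.
  lra.
have s3 : c / L * n <= 2 * c / (tau * L) * p.
  have -> : 2 * c / (tau * L) * p = c / L * (2 / tau * p) by field; rewrite !gt_eqF.
  rewrite ler_wpM2l ?divr_ge0 ?(ltW L0) // mulrAC ler_pdivlMr //; lra.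
lra.
Qed.

Section MainEstimate.
Context {R : realType} {X Y : euclideanType R} (D : smba_data X Y) (T : smba_trace X).
Context (eta : R).
Hypothesis hA : problem_assumption D.
Hypothesis hbase : compact_base D.
Hypothesis hB : smoothing_assumption D.
Hypothesis hC : stepsize_assumption (mu_ T).
Hypothesis hD : convex_assumption D.
Hypothesis hrun : smba_run D T.
Hypothesis heta : eta_valid D eta.

Local Notation mu := (mu_ T).
Local Notation x := (x_ T).
Local Notation lam k := (sub_lam T k (i_ T k) (j_ T k)).
Local Notation Lf k := (2 ^+ (i_ T k) * L_f0_ T k).
Local Notation Lg k := (2 ^+ (j_ T k) * L_g0_ T k).
Local Notation mu_gt0 := (run_mu_gt0 hrun).
Local Notation modulus k := (model_modulus T k (i_ T k) (j_ T k) (lam k)).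
Local Notation in_Omega0 := (iterate_Omega0 hA hbase hB hrun).

Lemma step_feasible k z : feasible D z ->
  psi D (x k.+1) - psi D z <= lam k * (alpha3 D * mu k)
    + (L_f D - Lf k) / 2 * `|x k.+1 - x k| ^+ 2
    + modulus k / 2 * (`|z - x k| ^+ 2 - `|z - x k.+1| ^+ 2).
Proof.
move=> fz; have vis := run_visited hrun k; have mk := mu_gt0 k.
have := sub_three_point hA hD hrun vis z.
rewrite -(run_next hrun) !(sub_objE hD hrun) !(psiE hD).
have := smooth_quadratic_bound (x k) (x k.+1) (f_smooth hA).
have [df _] := f_smooth hA.
have := convex_gradient_le (f_convex hD) z (df (x k)); rewrite -gradP.
have : lam k * sub_con D T k (j_ T k) z <= lam k * (alpha3 D * mu k)
    + lam k * Lg k / mu k / 2 * `|z - x k| ^+ 2.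
  have -> : lam k * Lg k / mu k / 2 * `|z - x k| ^+ 2 =
      lam k * (Lg k / (2 * mu k) * `|z - x k| ^+ 2).
    move: (lam k) (Lg k) (mu k) mk `|z - x k| => a b m m0 n.
    by field; rewrite gt_eqF.
  rewrite -mulrDr ler_wpM2l //; first exact: (sub_lam_ge0 hrun vis).
  by rewrite /sub_con lerD2r; exact: g_linearization_le.
rewrite /model_modulus.
move: (lam k * sub_con _ _ _ _ _) (lam k * (alpha3 D * mu k)) (lam k * Lg k / mu k) => c a b.
move: (dot _ (z - x k)) (dot _ (x k.+1 - x k)) => dz dp.
move: (obj_f D z) (obj_f D (x k)) (obj_f D (x k.+1)) => fz' fx fp.
move: (obj_P1 D z) (obj_P1 D (x k.+1)) => pz pp.
move: (`|z - x k| ^+ 2) (`|x k.+1 - x k| ^+ 2) (`|z - x k.+1| ^+ 2) (Lf k) => nz np nzp l.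
lra.
Qed.

Lemma M_1_gt0 : 0 < M_1 D mu eta.
Proof.
rewrite /M_1 divr_gt0 // mulr_gt0 ?(M_L_gt0 hrun) // ltr_pwDl ?mu_gt0 //.
exact: M_lambda_ge0.
Qed.

(** It remains to bound the modulus: [mu k] times it is [mu k * Lf + lam * Lg], at most
    [M_L * (mu_0 + M_lambda)], which is [2 * M_1]. *)
Lemma step_optimal k z : feasible D z -> psi D z <= psi D (x k.+1) ->
  mu k / M_1 D mu eta * (psi D (x k.+1) - psi D z) <=
  M_2 D * mu k ^+ 2 + M_3 D * (psi D (x k) - psi D (x k.+1))
    + (`|z - x k| ^+ 2 - `|z - x k.+1| ^+ 2).
Proof.
move=> fz pz; have vis := run_visited hrun k; have mk := mu_gt0 k.
have Lc := L_check_gt0 hrun.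
have l0 := sub_lam_ge0 hrun vis.
have lgk := Lg_ge hrun k (j_ T k).
have lfk := Lf_ge hrun k (i_ T k).
have [LfM LgM] := visited_factor_le hA hbase hB hD hrun (in_Omega0 k) (g_iterate_le0 hB hrun k) vis.
have lM := multiplier_le hA hbase hB hC hD hrun heta k.
have Lw : L_check D <= modulus k.
  rewrite (le_trans lfk) // lerDl divr_ge0 ?(ltW mk) // mulr_ge0 //.
  exact: le_trans (ltW Lc) lgk.
have mw : mu k * modulus k = mu k * Lf k + lam k * Lg k.
  by rewrite mulrDr [mu k * (_ / _)]mulrC divfK // gt_eqF.
apply: (weighted_step _ _ _ _ _ _ _ _ lfk Lw _ _ _ (step_feasible k fz)) => //.
- exact: lt_le_trans Lw.
- exact: M_1_gt0.
- exact: tau1_gt0 hrun.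
- by rewrite subr_ge0.
- exact/ltW/(alpha3_gt0 hB).
- rewrite mw ler_wpDl ?ler_wpM2l // mulr_ge0 ?(ltW mk) //.
  exact: le_trans (ltW Lc) lfk.
- rewrite mulrC mw /M_1 [2 * (_ / 2)]mulrC divfK ?pnatr_eq0 // mulrDr.
  apply: lerD.
    rewrite [leRHS]mulrC; apply: ler_pM => //; [exact: ltW|exact: le_trans (ltW Lc) lfk|].
    exact: run_mu_le hrun _ _ (leq0n k).
  rewrite [leRHS]mulrC; apply: ler_pM => //; exact: le_trans (ltW Lc) lgk.
rewrite lerBrDl; exact: iterate_descent.
Qed.

Lemma psi_decr_le m n : (m <= n)%N -> psi D (x n) <= psi D (x m).
Proof.
by move=> mn; rewrite -(subnK mn); elim: (n - m)%N => // d; apply: le_trans; exact: psi_decr.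
Qed.

(** Since [psi] decreases along the iterates, each earlier gap dominates the last one, which
    therefore factors out of the weighted sum. *)
Lemma sum_optimal m n z : (m <= n)%N -> solutions D z ->
  (\sum_(m <= k < n) mu k) / M_1 D mu eta * (psi D (x n) - psi D z) <=
  M_2 D * (\sum_(m <= k < n) mu k ^+ 2) + M_3 D * (psi D (x m) - psi D (x n))
    + (`|z - x m| ^+ 2 - `|z - x n| ^+ 2).
Proof.
move=> + [fz hz]; elim: n => [|n IH].
  by rewrite leqn0 => /eqP ->; rewrite !big_geq // !mul0r !subrr !mulr0 !addr0.
rewrite leq_eqVlt => /predU1P[->|].
  by rewrite !big_geq // !mul0r !subrr !mulr0 !addr0.
rewrite ltnS => mn; have {IH} := IH mn; rewrite !big_nat_recr //=.
have [_ fn] := in_Omega0 n.+1.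
have := step_optimal fz (hz _ fn).
have := psi_decr hrun n.
have M0 := M_1_gt0; have S0 : 0 <= \sum_(m <= k < n) mu k.
  by apply: sumr_ge0 => k _; exact/ltW/mu_gt0.
have mM : 0 <= (\sum_(m <= k < n) mu k) / M_1 D mu eta by rewrite divr_ge0 // ltW.
move: (psi D z) (psi D (x m)) (psi D (x n)) (psi D (x n.+1)) => pz pm pn pn1.
rewrite !mulrDl.
move: ((\sum_(m <= k < n) mu k) / M_1 D mu eta) mM (mu n / M_1 D mu eta) => a a0 b.
move: (\sum_(_ <= _ < _) _ ^+ 2) (mu n ^+ 2) (M_2 D) (M_3 D) => s t m2 m3.
move: (`|_| ^+ 2) (`|_| ^+ 2) (`|_| ^+ 2) => d1 d2 d3 h1 h2 h3.
have : a * pn1 <= a * pn by rewrite ler_wpM2l.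
lra.
Qed.

(** * Existence of solutions and the optimal value *)

Lemma psi_continuous : continuous (psi D : X -> R^o).
Proof.
have -> : (psi D : X -> R^o) = (fun z => (obj_f D z : R^o) + (obj_P1 D z : R^o)).
  by apply/funext => z; rewrite (psiE hD).
have [df _] := f_smooth hA.
move=> z; apply: cvgD; first exact/differentiable_continuous/df.
exact: (convex_continuous (P1_convex hA)).
Qed.

Lemma Omega0_compact : compact (Omega0 D).
Proof.
apply: bounded_closed_compactE; first exact: Omega0_bounded hA.
have -> : Omega0 D = ((psi D : X -> R^o) @^-1` [set t | t <= psi D (init_x D)])
    `&` (con_G D @^-1` con_K D) by [].
apply: closedI; apply: preimage_closed.
- by move=> z _; exact: psi_continuous.
- exact: closed_le.
- by move=> z _; exact/differentiable_continuous/(G_differentiable hA).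
- exact: K_closed hA.
Qed.

Lemma solution_exists : exists z, solutions D z.
Proof.
have N0 : Omega0 D !=set0 by exists (init_x D); exact: Omega0_init.
have [z] := compact_EVT_min N0 Omega0_compact (continuous_subspaceT psi_continuous).
rewrite inE => -[pz fz] hz; exists z; split=> // y fy.
have [py|py] := leP (psi D y) (psi D (init_x D)); first by apply: hz; rewrite inE.
exact: le_trans pz (ltW py).
Qed.

Lemma opt_valueE z : solutions D z -> opt_value D = psi D z.
Proof.
move=> [fz hz]; apply/eqP; rewrite eq_le; apply/andP; split.
  by apply: ge_inf; [exists (psi D z) => _ [y fy <-]; exact: hz|exists z].
by apply: lb_le_inf; [exists (psi D z), z|move=> _ [y fy <-]; exact: hz].
Qed.

End MainEstimate.

Section Conclusions.
Context {R : realType} {X Y : euclideanType R} (D : smba_data X Y) (T : smba_trace X).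
Context (eta : R).
Hypothesis hA : problem_assumption D.
Hypothesis hbase : compact_base D.
Hypothesis hB : smoothing_assumption D.
Hypothesis hC : stepsize_assumption (mu_ T).
Hypothesis hD : convex_assumption D.
Hypothesis hrun : smba_run D T.
Hypothesis heta : eta_valid D eta.

Local Notation mu := (mu_ T).
Local Notation x := (x_ T).
Local Notation mu_gt0 := (run_mu_gt0 hrun).
Local Notation in_Omega0 := (iterate_Omega0 hA hbase hB hrun).

Lemma M_2_ge0 : 0 <= M_2 D.
Proof.
by rewrite /M_2 divr_ge0 ?mulr_ge0 ?ltW ?(alpha3_gt0 hB) ?(L_check_gt0 hrun).
Qed.

Lemma M_3_ge0 : 0 <= M_3 D.
Proof.
rewrite /M_3 divr_ge0 ?mulr_ge0 ?le_max ?lexx //.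
  exact/ltW/(tau1_gt0 hrun).
exact/ltW/(L_check_gt0 hrun).
Qed.

Lemma sum_mu_gt0 n : 0 < \sum_(uphalf n <= k < n.+1) mu k.
Proof.
rewrite big_nat_recr /=; last by rewrite leq_uphalf_double -addnn leq_addr.
by rewrite ltr_wpDl ?mu_gt0 // sumr_ge0 // => k _; exact/ltW/mu_gt0.
Qed.

Lemma solution_Omega0 z : solutions D z -> Omega0 D z.
Proof.
by move=> [fz hz]; split => //; apply: hz; have [] := Omega0_init hA.
Qed.

Lemma rate_of_convergence n :
  psi D (x n.+1) - opt_value D <=
    M_1 D mu eta / (\sum_(uphalf n <= k < n.+1) mu k)
    * (M_2 D * (\sum_(uphalf n <= k < n.+1) mu k ^+ 2)
       + M_3 D * (psi D (init_x D) - opt_value D) + diam_Omega0 D ^+ 2).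
Proof.
have [z sz] := solution_exists hA hD; have zO := solution_Omega0 sz.
rewrite (opt_valueE sz).
have mn : (uphalf n <= n.+1)%N by rewrite leq_uphalf_double -addnn leqW // leq_addr.
have := sum_optimal hA hbase hB hC hD hrun heta mn sz.
have := sum_mu_gt0 n; set S := \sum_(_ <= _ < _) mu _ => S0.
have M0 := M_1_gt0 hA hbase hB hrun heta.
have M3 := M_3_ge0.
have psi1 : psi D z <= psi D (x n.+1) by have [_ hz] := sz; apply: hz; have [] := in_Omega0 n.+1.
have psi2 : psi D (x (uphalf n)) <= psi D (init_x D).
  by rewrite -(run_x0 hrun); exact: psi_decr_le.
have dz : `|z - x (uphalf n)| ^+ 2 <= diam_Omega0 D ^+ 2.
  have d0 : `|z - x (uphalf n)| <= diam_Omega0 D by apply: dist_le_diam => //; exact: in_Omega0.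
  by rewrite ler_pXn2r ?nnegrE // (le_trans _ d0).
set Q := _ + diam_Omega0 D ^+ 2 => hs.
have {}hs : S / M_1 D mu eta * (psi D (x n.+1) - psi D z) <= Q.
  apply: le_trans hs _; apply: lerD.
    by rewrite lerD2l; apply: ler_wpM2l => //; exact: lerB.
  by rewrite lerBlDr (le_trans dz) // lerDl sqr_ge0.
have -> : M_1 D mu eta / S * Q = Q / (S / M_1 D mu eta).
  by move: (M_1 D mu eta) M0 => m m0; field; rewrite !gt_eqF.
by rewrite (ler_pdivlMr _ _ (divr_gt0 S0 M0)) [leLHS]mulrC.
Qed.

Section SquareSummable.
Hypothesis mu2 : cvgn (series (fun k => mu k ^+ 2)).

Local Notation partial k := (\sum_(0 <= i < k) mu i ^+ 2).
Let total : R := limn (series (fun k => mu k ^+ 2)).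

Lemma partial_le_total k : partial k <= total.
Proof.
apply: (@nondecreasing_cvgn_le _ (series (fun k => mu k ^+ 2))) => //.
by apply/nondecreasing_seqP => n; rewrite /series /= big_nat_recr //= lerDl sqr_ge0.
Qed.

(* The weights turn the error terms of step_optimal into differences of
   consecutive values. *)
Definition lyapunov z k := `|z - x k| ^+ 2 + M_3 D * (psi D (x k) - opt_value D)
  + M_2 D * (total - partial k).

(** This is quasi-Fejer monotonicity: the left side of [step_optimal] is nonnegative and is
    dropped. *)
Lemma lyapunov_decr z k l : solutions D z -> (k <= l)%N -> lyapunov z l <= lyapunov z k.
Proof.
move=> sz kl; rewrite -(subnK kl); elim: (l - k)%N => // n; apply: le_trans.
have [fz hz] := sz; have [_ fn] := in_Omega0 (n + k).+1.
have pz := hz _ fn.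
have := step_optimal hA hbase hB hC hD hrun heta fz pz.
have : 0 <= mu (n + k) / M_1 D mu eta * (psi D (x (n + k).+1) - psi D z).
  apply: mulr_ge0; last by rewrite subr_ge0.
  apply: divr_ge0; first exact/ltW/mu_gt0.
  exact/ltW/(M_1_gt0 hA hbase hB hrun heta).
rewrite addSn /lyapunov (opt_valueE sz) big_nat_recr //=.
move: (_ / _ * _) (\sum_(_ <= _ < _) _) (mu (n + k) ^+ 2) total => e s t u.
move: (psi D z) (psi D (x (n + k).+1)) (psi D (x (n + k))) => p p1 p0.
move: (`|_| ^+ 2) (`|_| ^+ 2) => d1 d2 *; lra.
Qed.

(** Square summability keeps the numerator of the rate below the constant [C], while the sums of
    [mu] in the denominator diverge. *)
Lemma psi_gap_small (e : R) : 0 < e ->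
  exists N, forall n, (N <= n)%N -> psi D (x n) - opt_value D <= e.
Proof.
move=> e0; set C := M_1 D mu eta * (M_2 D * total
   + M_3 D * (psi D (init_x D) - opt_value D) + diam_Omega0 D ^+ 2).
have /cvgryPge/(_ (C / e))[N _ hN] := mu_sum hC.
exists N.+1 => -[//|n]; rewrite ltnS => /hN /= hS.
apply: le_trans (rate_of_convergence n) _.
have S0 := sum_mu_gt0 n.
rewrite mulrAC ler_pdivrMr //.
rewrite ler_pdivrMr // mulrC in hS; apply: le_trans hS.
rewrite /C ler_pM2l ?(M_1_gt0 hA hbase hB hrun heta) // !lerD2r.
rewrite ler_wpM2l ?M_2_ge0 //; apply: le_trans (partial_le_total n.+1).
have un : (uphalf n <= n.+1)%N by rewrite leq_uphalf_double -addnn leqW // leq_addr.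
rewrite [leRHS](big_cat_nat _ un) //= lerDr.
by apply: sumr_ge0 => k _; exact: sqr_ge0.
Qed.

Lemma total_gap_small (e : R) : 0 < e ->
  exists N, forall n, (N <= n)%N -> total - partial n <= e.
Proof.
move=> e0; have /cvgrPdist_le/(_ _ e0)[N _ hN] := mu2.
exists N => n /hN /=; apply: le_trans; exact: ler_norm.
Qed.

Lemma iterates_converge : exists2 xstar, solutions D xstar & x @ \oo --> xstar.
Proof.
have [z sz] := solution_exists hA hD.
have FO : (x @ \oo) (Omega0 D) by exists 0%N => // n _; exact: in_Omega0.
have [xs [Oxs cl]] := Omega0_compact hA hD _ FO.
(* The iterates enter every neighbourhood of the cluster point at arbitrarily late indices. *)
have meets N (B : set X) : nbhs xs B -> exists2 n, (N <= n)%N & B (x n).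
  move=> nB; have FA : (x @ \oo) (x @` [set n | (N <= n)%N]).
    by exists N => // n Nn; exists n.
  by have [_ [[n Nn <-] Bn]] := cl _ _ FA nB; exists n.
have sxs : solutions D xs.
  split; first by case: Oxs.
  suff le_opt : psi D xs <= psi D z by move=> y fy; apply: le_trans le_opt _; case: sz => _; apply.
  rewrite leNgt; apply/negP => lt_opt.
  set e := (psi D xs - psi D z) / 2; have e0 : 0 < e by rewrite divr_gt0 // subr_gt0.
  have [N hN] := psi_gap_small e0.
  have /cvgrPdist_lt/(_ _ e0)/(meets N) [n Nn /=] := @psi_continuous _ _ _ D hA hD xs.
  have := hN n Nn; rewrite (opt_valueE sz) => h1 /ltr_normlW h2.
  have : psi D xs - psi D z = 2 * e by rewrite /e mulrC divfK ?pnatr_eq0.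
  lra.
have gap_ge0 k : 0 <= psi D (x k) - opt_value D.
  have [_ hz] := sz; rewrite subr_ge0 (opt_valueE sz); apply: hz.
  by have [] := in_Omega0 k.
exists xs => //; apply/cvgrPdist_lt => e e0.
have M2 := M_2_ge0; have M3 := M_3_ge0.
(* Each of the three terms of [lyapunov] is brought to at most [d], for a total below [4 * d]. The
   tolerances are divided by [M_3 + 1] and [M_2 + 1] because [M_3] may vanish. *)
pose d := e ^+ 2 / 4; have d0 : 0 < d by rewrite divr_gt0 ?exprn_gt0.
have [N1 h1] := psi_gap_small (divr_gt0 d0 (ltr_wpDl M3 ltr01)).
have [N2 h2] := total_gap_small (divr_gt0 d0 (ltr_wpDl M2 ltr01)).
have he : nbhs xs [set y | `|xs - y| < e / 2].
  have /cvgrPdist_lt h : id @ nbhs xs --> xs by exact: cvg_id.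
  by apply: h; rewrite divr_gt0.
have [k kN /= hk] := meets (maxn N1 N2) _ he.
have Vk : lyapunov xs k < e ^+ 2.
  have a1 : `|xs - x k| ^+ 2 < d.
    have -> : d = (e / 2) ^+ 2 by rewrite /d; field.
    by rewrite ltr_pXn2r ?nnegrE // divr_ge0 // ltW.
  have a2 : M_3 D * (psi D (x k) - opt_value D) <= d.
    have := h1 k (leq_trans (leq_maxl _ _) kN).
    rewrite ler_pdivlMr ?ltr_wpDl // => hh; apply: le_trans hh.
    by rewrite [leRHS]mulrDr mulr1 [leLHS]mulrC lerDl gap_ge0.
  have a3 : M_2 D * (total - partial k) <= d.
    have := h2 k (leq_trans (leq_maxr _ _) kN).
    rewrite ler_pdivlMr ?ltr_wpDl // => hh; apply: le_trans hh.
    by rewrite [leRHS]mulrDr mulr1 [leLHS]mulrC lerDl subr_ge0 partial_le_total.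
  have : e ^+ 2 = 4 * d by rewrite /d mulrC divfK ?pnatr_eq0.
  rewrite /lyapunov; lra.
exists k => // n kn.
have := le_lt_trans (lyapunov_decr sxs kn) Vk.
have gap := mulr_ge0 M3 (gap_ge0 n).
have tail : 0 <= M_2 D * (total - partial n).
  by rewrite mulr_ge0 // subr_ge0 partial_le_total.
move=> Vn; have : `|xs - x n| ^+ 2 < e ^+ 2.
  by apply: le_lt_trans Vn; rewrite /lyapunov -addrA lerDl addr_ge0.
by rewrite ltr_pXn2r ?nnegrE // ltW.
Qed.

End SquareSummable.
End Conclusions.
Theorem theorem4p3 (R : realType) (X Y : euclideanType R)
    (D : smba_data X Y) (T : smba_trace X) (eta : R)
    (hA : problem_assumption D)
    (hbase : compact_base D)
    (hB : smoothing_assumption D)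
    (hC : stepsize_assumption (mu_ T))
    (hD : convex_assumption D)
    (hrun : smba_run D T)
    (heta : eta_valid D eta) :
  (forall n : nat,
     psi D (x_ T n.+1) - opt_value D <=
       M_1 D (mu_ T) eta / (\sum_(uphalf n <= k < n.+1) mu_ T k)
       * (M_2 D * (\sum_(uphalf n <= k < n.+1) mu_ T k ^+ 2)
          + M_3 D * (psi D (init_x D) - opt_value D)
          + diam_Omega0 D ^+ 2))
  /\
  (cvgn (series (fun k => mu_ T k ^+ 2)) ->
   exists2 xstar, solutions D xstar & x_ T @ \oo --> xstar).
Proof.
split; first by move=> n; exact: rate_of_convergence.
by move=> mu2; exact: iterates_converge heta mu2.
Qed.
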